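(* Let $p\in(1,\infty)$ and let $\mathbf{T}$ be a $C_0$-semigroup of composition operators on $H^p(\Pi)$ induced by a semigroup $\mathbf{F}=\{F_t\}_{t\ge0}\subset\mathrm{Hol}(\Pi)$. If $\mathbf{T}$ can be analytically extended to a sector, then $\mathbf{F}$ is of parabolic type.
   Context: $\Pi=\{z\in\mathbb{C}:\mathrm{Re}\,z>0\}$; $\mathrm{Hol}(\Pi,\mathbb{C})$ is the set of holomorphic functions on $\Pi$ and $\mathrm{Hol}(\Pi)$ the set of holomorphic self-maps of $\Pi$. The Hardy space is $$H^p(\Pi)=\Big\{\varphi\in\mathrm{Hol}(\Pi,\mathbb{C}):\ \|\varphi\|=\sup_{x>0}\Big(\frac1\pi\int_{-\infty}^{\infty}|\varphi(x+iy)|^p\,dy\Big)^{1/p}<\infty\Big\}.$$ A (one-parameter continuous) semigroup on $\Pi$ is a family $\{F_t\}_{t\ge0}\subset\mathrm{Hol}(\Pi)$ with $F_t\circ F_s=F_{t+s}$ for all $t,s\ge0$ and $\lim_{t\to0^+}F_t(z)=z$ for all $z\in\Pi$; its generator is $f(z)=\lim_{t\to0^+}\frac{F_t(z)-z}{t}$. The semigroup of composition operators induced by $\mathbf{F}$ is $T(t)\varphi=\varphi\circ F_t$. A $C_0$-semigroup is a family $\{T(t),t\ge0\}$ of bounded linear operators with $T(t)T(s)=T(t+s)$ and $\lim_{t\to0^+}T(t)=T(0)=I$ (strongly). A semigroup that contains neither the identity nor an elliptic automorphism (for $t>0$) has a unique Denjoy--Wolff point $\tau\in\overline{\Pi}\cup\{\infty\}$,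 to which $F_t(z)$ converges as $t\to\infty$ for all $z\in\Pi$. A semigroup with Denjoy--Wolff point at $\infty$ and generator $f$ is of parabolic type if the angular (non-tangential) limit of $\frac{f(z)}{z+1}$ as $z\to\infty$ is $0$, and of hyperbolic type if this limit is positive. A sector is an open sector $\Omega=\{\zeta:-\theta_1<\arg\zeta<\theta_2\}$ with $\theta_1,\theta_2>0$. Analytic extension of $\{T(t)\}$ to $\Omega$ is meant in the standard sense: a family of bounded operators $T(\zeta)$, analytic in $\zeta\in\Omega$, equal to the given $T(t)$ for $\zeta=t>0$, with $T(\zeta_1)T(\zeta_2)=T(\zeta_1+\zeta_2)$ and $T(\zeta)x\to x$ as $\zeta\to0$ in $\Omega$.
   Formalization: The semigroup F is assumed nontrivial (some F_t is not the identity map of Π): for F_t = id, T(t) = I extends analytically to any sector, but F has no Denjoy–Wolff point and so is not of parabolic type. *)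

(* Defs.v *)
From HB Require Import structures.
From mathcomp Require Import all_boot all_order all_algebra.
From mathcomp Require Import complex.
From mathcomp Require Import all_classical all_reals all_analysis.

Set Implicit Arguments.
Unset Strict Implicit.
Unset Printing Implicit Defensive.

Import Order.TTheory GRing.Theory Num.Theory numFieldNormedType.Exports.

Local Open Scope classical_set_scope.
Local Open Scope ring_scope.
Local Open Scope complex_scope.

(* The complex numbers R[i] as a normed space over themselves: a function
   f : R[i] -> R[i] is complex differentiable at z iff [derivable f z 1]. *)
HB.instance Definition _ (R : rcfType) := NormedModule.copy R[i] R[i]^o.

Section HalfPlane.
Variable R : realType.
Local Notation C := R[i].

(* The modulus as a real number; the library norm `|z| is an element of R[i]. *)
Definition cmod (z : C) : R := complex.Re `|z|.

Definition RHP : set C := [set z | 0 < complex.Re z].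

(* Functions on the half-plane are represented by total functions C -> C; their
   values outside RHP are irrelevant to every notion below. *)
Definition holomorphic_RHP (phi : C -> C) : Prop :=
  forall z, RHP z -> derivable phi z 1.

Definition eq_RHP (phi psi : C -> C) : Prop :=
  forall z, RHP z -> phi z = psi z.

Definition holomorphic_self_map (g : C -> C) : Prop :=
  holomorphic_RHP g /\ forall z, RHP z -> RHP (g z).

Definition holomorphic_semigroup (F : R -> C -> C) : Prop :=
  [/\ forall t, 0 <= t -> holomorphic_self_map (F t),
      forall t s, 0 <= t -> 0 <= s -> eq_RHP (F t \o F s) (F (t + s))
    & forall z, RHP z -> F t z @[t --> 0^'+] --> (z : C)].

(* The semigroup F t = id has no Denjoy-Wolff point, hence no type. *)
Definition nontrivial_semigroup (F : R -> C -> C) : Prop :=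
  exists t z, [/\ 0 <= t, RHP z & F t z <> z].

Definition is_generator (F : R -> C -> C) (f : C -> C) : Prop :=
  forall z, RHP z -> (F t z - z) / t%:C @[t --> 0^'+] --> (f z : C).

(* This convergence excludes the identity and elliptic automorphisms among the
   F t with t > 0: either would give a z with bounded orbit. *)
Definition Denjoy_Wolff_at_infinity (F : R -> C -> C) : Prop :=
  forall z, RHP z -> cmod (F t z) @[t --> +oo] --> +oo.

(* [cmod z <= M * Re z] is the closed sector |arg z| <= arccos (1 / M); for
   M > 1 these exhaust the non-tangential approach regions to infinity. *)
Definition angular_limit_at_infinity (g : C -> C) (l : C) : Prop :=
  forall M eps : R, 0 < eps -> exists K : R, forall z,
    RHP z -> cmod z <= M * complex.Re z -> K < cmod z -> cmod (g z - l) < eps.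

Definition parabolic_type (F : R -> C -> C) : Prop :=
  Denjoy_Wolff_at_infinity F /\
  exists f, is_generator F f /\
            angular_limit_at_infinity (fun z => f z / (z + 1)) 0.

Definition hardy_norm (p : R) (phi : C -> C) : \bar R :=
  ereal_sup
    [set (((pi^-1)%:E *
           \int[lebesgue_measure]_y ((cmod (phi (x +i* y))) `^ p)%:E)
          `^ p^-1)%E | x in [set x : R | 0 < x]].

Definition hardy (p : R) : set (C -> C) :=
  [set phi | holomorphic_RHP phi /\ (hardy_norm p phi < +oo)%E].

Local Notation operator := ((C -> C) -> (C -> C)).

(* Elements of H^p are functions up to [eq_RHP]. Linearity and boundedness
   together force A to respect this equality, since [hardy_norm] vanishes only
   on functions that are zero on RHP. *)
Definition bounded_linear (p : R) (A : operator) : Prop :=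
  [/\ forall phi, hardy p phi -> hardy p (A phi),
      forall (a : C) phi psi, hardy p phi -> hardy p psi ->
        eq_RHP (A (fun z => a * phi z + psi z))
               (fun z => a * A phi z + A psi z)
    & exists M : R, forall phi, hardy p phi ->
        (hardy_norm p (A phi) <= M%:E * hardy_norm p phi)%E].

Definition op_norm (p : R) (A : operator) : \bar R :=
  ereal_sup [set hardy_norm p (A phi)
            | phi in [set phi | hardy p phi /\ (hardy_norm p phi <= 1)%E]].

Definition C0_semigroup (p : R) (T : R -> operator) : Prop :=
  [/\ forall t, 0 <= t -> bounded_linear p (T t),
      forall t s, 0 <= t -> 0 <= s -> forall phi, hardy p phi ->
        eq_RHP (T t (T s phi)) (T (t + s) phi),
      forall phi, hardy p phi -> eq_RHP (T 0 phi) phi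
    & forall phi, hardy p phi ->
        hardy_norm p (T t phi \- phi) @[t --> 0^'+] --> 0%E].

Definition composition_semigroup (F : R -> C -> C) : R -> operator :=
  fun t phi => phi \o F t.

(* The set of r e^{i theta} with r > 0 and - theta1 < theta < theta2. For
   theta1, theta2 <= pi this is {- theta1 < arg < theta2} with the principal
   argument. *)
Definition sector (theta1 theta2 : R) : set C :=
  [set zeta | exists r theta : R,
    [/\ 0 < r, - theta1 < theta, theta < theta2
      & zeta = (r * cos theta) +i* (r * sin theta)]].

(* Complex differentiability in the operator norm. *)
Definition op_analytic_at (p : R) (S : C -> operator) (zeta : C) : Prop :=
  exists2 D : operator, bounded_linear p D &
    op_norm p (fun phi z =>
      (S (zeta + h) phi z - S zeta phi z) / h - D phi z)
    @[h --> (0 : C)^'] --> 0%E.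

(* For a non-convex sector the semigroup law is only required where
   zeta1 + zeta2 still lies in the sector. *)
Definition analytic_extension (p : R) (T : R -> operator) (Omega : set C)
    (S : C -> operator) : Prop :=
  [/\ forall zeta, Omega zeta -> bounded_linear p (S zeta),
      forall zeta, Omega zeta -> op_analytic_at p S zeta,
      forall t, 0 < t -> forall phi, hardy p phi ->
        eq_RHP (S t%:C phi) (T t phi),
      forall zeta1 zeta2, Omega zeta1 -> Omega zeta2 ->
        Omega (zeta1 + zeta2) -> forall phi, hardy p phi ->
        eq_RHP (S zeta1 (S zeta2 phi)) (S (zeta1 + zeta2) phi)
    & forall phi, hardy p phi ->
        hardy_norm p (S zeta phi \- phi)
        @[zeta --> within Omega (nbhs (0 : C))] --> 0%E].

Definition analytically_extendable (p : R) (T : R -> operator) : Prop :=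
  exists theta1 theta2 : R, [/\ 0 < theta1, 0 < theta2
    & exists S, analytic_extension p T (sector theta1 theta2) S].

End HalfPlane.

(* Main.v *)
Require Import Defs.
From mathcomp Require Import all_boot all_order all_algebra.
From mathcomp Require Import complex ring lra.
From mathcomp Require Import all_classical all_reals all_analysis.
From mathcomp Require Import measurable_realfun.

(** The angular derivative at infinity of [F t] decides the type, and analyticity
    of the operator semigroup forces it to be [1].

    Boundedness of the composition operator with [F t] makes the infimum
    [slope (F t)] of [Re (F t z) / Re z] positive ([bounded_slope_gt0]). By the
    Julia-Wolff-Caratheodory theorem ([slope_angular]) [F t z] is asymptotic to
    [slope (F t) * z] in every sector, so the slopes multiply along the semigroup
    ([slope_comp]).

    Seen from far away, the operator at time [t] is therefore the dilation
    [phi |-> phi (slope (F t) * z)]. Dilations by distinct factors are at a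
    distance bounded below in operator norm ([slope_gap]), whereas an analytic
    semigroup is Lipschitz in operator norm at positive times
    ([analytic_lipschitz]). Hence [slope (F t) = 1] for all [t > 0]
    ([semigroup_slope_eq1]).

    Then [F t] never decreases real parts, so the displacements [F t z - z] have
    nonnegative real part and satisfy Harnack's inequality. A nontrivial such
    semigroup escapes to infinity: on an orbit that returns to a bounded region,
    [Re (F t z)] converges, and the displacement would have to be purely
    imaginary; then the [F t] are vertical translations, whose orbits are
    unbounded ([semigroup_escapes]). Harnack's inequality along an orbit also
    shows that [(F t z - z) / t] is Cauchy as [t] tends to [0], which gives the
    generator [f] ([generator_exists]). The limit [f] inherits the Schwarz-Pick
    inequality, and [Re f / Re z] has infimum [0], for otherwise the slope of
    [F 1] would exceed [1] ([generator_slope0]). Julia's lemma then gives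
    [f z / (z + 1) -> 0] in every sector ([generator_angular]).

    The one fact of complex analysis behind all this is the Schwarz-Pick
    inequality ([schwarz_pick]). As holomorphy means differentiability at each
    point and no more, it is derived from Goursat's theorem: bisection gives the
    vanishing of fluxes over rectangles ([flux_eq0]); in logarithmic polar
    coordinates this is the mean value property ([mean_value_le]), which yields
    the maximum principle ([Re_maximum_principle]) and the Schwarz lemma. *)

Set Implicit Arguments.
Unset Strict Implicit.
Unset Printing Implicit Defensive.

Import Order.TTheory GRing.Theory Num.Theory numFieldNormedType.Exports.

Local Open Scope classical_set_scope.
Local Open Scope ring_scope.
Local Open Scope complex_scope.

(** * Modulus and first-order expansions of complex functions *)

Section ComplexModulus.
Variable R : realType.
Local Notation C := R[i].
Implicit Types (z w : C) (f g : C -> C).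

Lemma cmodE z : cmod z = Num.sqrt (complex.Re z ^+ 2 + complex.Im z ^+ 2).
Proof. by case: z. Qed.

Lemma cmod_ge0 z : 0 <= cmod z.
Proof. by rewrite cmodE sqrtr_ge0. Qed.

Lemma sqr_cmod z : cmod z ^+ 2 = complex.Re z ^+ 2 + complex.Im z ^+ 2.
Proof. by rewrite cmodE sqr_sqrtr // addr_ge0 // sqr_ge0. Qed.

Lemma normE z : `|z| = (cmod z)%:C.
Proof. by rewrite normc_def cmodE. Qed.

Lemma cmodM z w : cmod (z * w) = cmod z * cmod w.
Proof. by apply: complexI; rewrite rmorphM /= -!normE normrM. Qed.

Lemma cmodN z : cmod (- z) = cmod z.
Proof. by apply: complexI; rewrite -!normE normrN. Qed.

Lemma cmodB z w : cmod (z - w) = cmod (w - z).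
Proof. by rewrite -cmodN opprB. Qed.

Lemma cmodV z : cmod z^-1 = (cmod z)^-1.
Proof. by apply: complexI; rewrite fmorphV /= -!normE normfV. Qed.

Lemma cmodD z w : cmod (z + w) <= cmod z + cmod w.
Proof. by rewrite -lecR rmorphD /= -!normE ler_normD. Qed.

Lemma cmod_real (x : R) : cmod x%:C = `|x|.
Proof. by rewrite cmodE /= expr0n addr0 sqrtr_sqr. Qed.

Lemma cmodMn z n : cmod (z *+ n) = cmod z * n%:R.
Proof. by rewrite -[z *+ n]mulr_natr cmodM -(rmorph_nat (real_complex R)) cmod_real normr_nat. Qed.

Lemma cmod0 : cmod (0 : C) = 0.
Proof. by rewrite (cmod_real 0) normr0. Qed.

Lemma cmod_eq0 z : cmod z = 0 -> z = 0.
Proof. by move=> h; apply/eqP; rewrite -normr_eq0 normE h. Qed.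

Lemma cmod_gt0 z : z != 0 -> 0 < cmod z.
Proof.
move=> z0; rewrite lt_neqAle cmod_ge0 andbT eq_sym.
by apply: contraNneq z0 => /cmod_eq0 ->.
Qed.

Lemma norm_Re_cmod z : `|complex.Re z| <= cmod z.
Proof. by rewrite cmodE -sqrtr_sqr ler_wsqrtr // lerDl sqr_ge0. Qed.

Lemma norm_Im_cmod z : `|complex.Im z| <= cmod z.
Proof. by rewrite cmodE -sqrtr_sqr ler_wsqrtr // lerDr sqr_ge0. Qed.

Lemma Re_cmod z : complex.Re z <= cmod z.
Proof. exact: le_trans (ler_norm _) (norm_Re_cmod z). Qed.

Lemma cmod_le_ReIm z : cmod z <= `|complex.Re z| + `|complex.Im z|.
Proof.
rewrite {1}[z]complexE; apply: le_trans (cmodD _ _) _.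
rewrite cmodM !cmod_real (_ : cmod 'i = 1) ?mul1r//.
by rewrite cmodE /= expr0n expr1n add0r sqrtr1.
Qed.

Lemma ReD z w : complex.Re (z + w) = complex.Re z + complex.Re w.
Proof. by case: z; case: w. Qed.
Lemma ImD z w : complex.Im (z + w) = complex.Im z + complex.Im w.
Proof. by case: z; case: w. Qed.
Lemma ReN z : complex.Re (- z) = - complex.Re z.
Proof. by case: z. Qed.
Lemma ImN z : complex.Im (- z) = - complex.Im z.
Proof. by case: z. Qed.
Lemma ReB z w : complex.Re (z - w) = complex.Re z - complex.Re w.
Proof. by rewrite ReD ReN. Qed.
Lemma ImB z w : complex.Im (z - w) = complex.Im z - complex.Im w.
Proof. by rewrite ImD ImN. Qed.
Lemma ReM z w : complex.Re (z * w) =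
  complex.Re z * complex.Re w - complex.Im z * complex.Im w.
Proof. by case: z; case: w. Qed.
Lemma ImM z w : complex.Im (z * w) =
  complex.Re z * complex.Im w + complex.Im z * complex.Re w.
Proof. by case: z => a b; case: w => c d /=; rewrite [b * c]mulrC [X in X = _]addrC addrC. Qed.
Lemma ReJ z : complex.Re z^* = complex.Re z.
Proof. by case: z. Qed.
Lemma ImJ z : complex.Im z^* = - complex.Im z.
Proof. by case: z. Qed.

Lemma ReIm_inj z w :
  complex.Re z = complex.Re w -> complex.Im z = complex.Im w -> z = w.
Proof. by case: z => a b; case: w => c d /= -> ->. Qed.

Lemma cmod_lt_ball z w (e : R) : ball z e%:C w <-> cmod (z - w) < e.
Proof. by rewrite /ball /= normE ltcR. Qed.

(** Complex differentiability as a real epsilon-delta statement, so that it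
    splits into first-order expansions of the real and imaginary parts. *)
Definition cdiff f z (l : C) := forall eps : R, 0 < eps ->
  exists2 d : R, 0 < d & forall k, cmod k < d ->
    cmod (f (z + k) - f z - l * k) <= eps * cmod k.

Lemma real_pos (e : C) : 0 < e -> exists2 r : R, 0 < r & e = r%:C.
Proof.
case: e => a b; rewrite ltcE /= => /andP[/eqP -> a0]; by exists a.
Qed.

Lemma nbhs_cmod z (P : set C) :
  nbhs z P <-> exists2 d : R, 0 < d & forall w, cmod (w - z) < d -> P w.
Proof.
split.
- move=> /nbhs_ballP [e /= e0 he].
  have [r r0 re] := real_pos e0.
  exists r => // w hw; apply: he; rewrite re; apply/cmod_lt_ball.
  by rewrite cmodB.
- move=> [d d0 hd]; apply/nbhs_ballP; exists d%:C => /=; first by rewrite ltcR.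
  by move=> w /cmod_lt_ball hw; apply: hd; rewrite cmodB.
Qed.

Lemma cvg_cmod (T : Type) (F : set_system T) (FF : Filter F) (g : T -> C) (l : C) :
  g @ F --> l <-> forall e : R, 0 < e -> \forall x \near F, cmod (g x - l) < e.
Proof.
split.
- move=> h e e0; apply: (h [set w | cmod (w - l) < e]).
  by apply/nbhs_cmod; exists e.
- move=> h P /nbhs_cmod[d d0 hd]; rewrite /= nbhs_simpl.
  by apply: filterS (h d d0) => x /hd.
Qed.

Lemma derivable_cdiff f z : derivable f z 1 -> exists l, cdiff f z l.
Proof.
move=> /cvg_ex [l hl]; exists l => e e0.
move/cvg_cmod: hl => /(_ e e0) /nbhs_cmod [d d0 hd].
exists d => // k hk; have [->|k0] := eqVneq k 0.
  by rewrite mulr0 !subr0 addr0 subrr cmod0 mulr0.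
have := hd k; rewrite subr0 => /(_ hk k0) /ltW.
rewrite /= /GRing.scale /= mulr1 [k + z]addrC => hh.
have -> : f (z + k) - f z - l * k = (k^-1 * (f (z + k) - f z) - l) * k.
  by rewrite mulrBl mulrAC mulVf // mul1r.
by rewrite cmodM ler_wpM2r ?cmod_ge0.
Qed.

Definition continuous_at_C (f : C -> C) z := forall eps : R, 0 < eps ->
  exists2 d : R, 0 < d & forall w, cmod (w - z) < d -> cmod (f w - f z) < eps.

Lemma cdiff_continuous f z l : cdiff f z l -> continuous_at_C f z.
Proof.
move=> h e e0; have [d d0 hd] := h 1 ltr01.
pose m := 1 + cmod l.
have m0 : 0 < m by rewrite ltr_pwDl // cmod_ge0.
exists (Num.min d (e / m)); first by rewrite lt_min d0 divr_gt0.
move=> w; rewrite lt_min => /andP[h1 h2].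
have := hd _ h1; rewrite [z + _]addrC subrK mul1r => h3.
have -> : f w - f z = (f w - f z - l * (w - z)) + l * (w - z) by rewrite subrK.
apply: le_lt_trans (cmodD _ _) _; rewrite cmodM.
apply: (@le_lt_trans _ _ (m * cmod (w - z))).
  by rewrite mulrDl mul1r lerD2r.
by rewrite mulrC -ltr_pdivlMr.
Qed.

End ComplexModulus.

(** * Goursat's theorem on rectangles *)

Section SegmentIntegral.
Variable R : realType.
Implicit Types (f g : R -> R) (a b c : R).

Definition continuous_on_seg f a b := {in `[a, b], continuous f}.

Definition intg f a b : R := \int[@lebesgue_measure R]_(x in `[a, b]) f x.

Lemma seg_integrable f a b : continuous_on_seg f a b ->
  (@lebesgue_measure R).-integrable `[a, b] (EFin \o f).
Proof.
move=> cf; apply: continuous_compact_integrable; first exact: segment_compact.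
by apply: continuous_in_subspaceT => x /[!inE] /cf.
Qed.

Lemma intg_cst (k : R) a b : a <= b -> intg (fun=> k) a b = k * (b - a).
Proof.
move=> ab; rewrite /intg Rintegral_cst //=.
by rewrite lebesgue_measure_itv /= lte_fin; rewrite le_eqVlt in ab;
  case/predU1P: ab => [->|->]; rewrite ?ltxx ?subrr ?mulr0 //= -EFinB.
Qed.

Lemma intgB f g a b : continuous_on_seg f a b -> continuous_on_seg g a b ->
  intg (fun x => f x - g x) a b = intg f a b - intg g a b.
Proof. by move=> cf cg; rewrite /intg RintegralB //; exact: seg_integrable. Qed.

Lemma le_intg f g a b : continuous_on_seg f a b -> continuous_on_seg g a b ->
  (forall x, a <= x <= b -> f x <= g x) -> intg f a b <= intg g a b.
Proof.
move=> cf cg fg; apply: le_Rintegral => //.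
- exact: seg_integrable.
- exact: seg_integrable.
Qed.

Lemma intg_near_cst f (k e : R) a b : a <= b -> continuous_on_seg f a b ->
  (forall x, a <= x <= b -> `|f x - k| <= e) ->
  `|intg f a b - k * (b - a)| <= e * (b - a).
Proof.
move=> ab cf fk.
have cc (r : R) : continuous_on_seg (fun=> r) a b by move=> x _; exact: cvg_cst.
have lo : intg (fun=> k - e) a b <= intg f a b.
  by apply: le_intg => // x /fk; rewrite ler_norml => /andP[]; lra.
have up : intg f a b <= intg (fun=> k + e) a b.
  by apply: le_intg => // x /fk; rewrite ler_norml => /andP[]; lra.
move: lo up; rewrite !intg_cst // ler_norml => lo up.
apply/andP; split; lra.
Qed.

Lemma intg_split f a b c : a <= c -> c <= b -> continuous_on_seg f a b ->
  intg f a b = intg f a c + intg f c b.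
Proof.
move=> ac cb cf; have fi := seg_integrable cf.
have := @Rintegral_itvB R f (BLeft a) (BRight b) c fi.
rewrite !bnd_simp => /(_ ac cb) h.
rewrite /intg -(Rintegral_itv_obnd_cbnd (r := c)); last first.
  apply: integrableS fi => //; apply: subset_itvr; rewrite bnd_simp //.
by rewrite -h addrC subrK.
Qed.

End SegmentIntegral.

Section Green.
Variable R : realType.
Variables u v : R -> R -> R.

(** Of the two Cauchy-Riemann equations only [u_x = v_y] (the coefficient [al]
    shared by both expansions) is recorded: it says that the field [(u, - v)]
    has divergence zero. *)
Definition flux_free x y := exists al be ga : R, forall eps, 0 < eps ->
  exists2 d : R, 0 < d & forall a b, `|a| < d -> `|b| < d ->
    `|u (x + a) (y + b) - u x y - (al * a + be * b)| <= eps * (`|a| + `|b|) /\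
    `|v (x + a) (y + b) - v x y - (ga * a + al * b)| <= eps * (`|a| + `|b|).


(** Up to sign, the flux of the field [(u, - v)] through the boundary of the
    rectangle with sides [[a, b]] and [[c, d]]. *)
Definition flux a b c d : R :=
  (intg (v ^~ d) a b - intg (v ^~ c) a b) - (intg (u b) c d - intg (u a) c d).

Lemma first_order_continuous (g : R -> R) (x al K : R) :
  0 <= K ->
  (exists2 d : R, 0 < d & forall a, `|a| < d ->
     `|g (x + a) - g x - al * a| <= K * `|a|) -> {for x, continuous g}.
Proof.
move=> K0 [d d0 hd]; apply/cvgrPdist_lt => /= e e0.
pose m := 1 + K + `|al|.
have m0 : 0 < m by rewrite ltr_pwDl // ltr_pwDl.
near=> y.
have yx : `|y - x| < Num.min d (e / m).
  rewrite distrC; near: y; apply: (nbhsx_ballx x).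
  by rewrite lt_min d0 divr_gt0.
move: yx; rewrite lt_min => /andP[h1 h2].
have := hd _ h1; rewrite [x + _]addrC subrK => h3.
rewrite distrC -(subrK (al * (y - x)) (g y - g x)).
apply: le_lt_trans (ler_normD _ _) _; rewrite normrM.
apply: (@le_lt_trans _ _ ((K + `|al|) * `|y - x|)).
  by rewrite mulrDl lerD2r.
apply: (@le_lt_trans _ _ (m * `|y - x|)).
  by rewrite ler_wpM2r // /m -addrA lerDr.
by rewrite mulrC -ltr_pdivlMr.
Unshelve. all: by end_near. Qed.

Definition flux_free_on a b c d :=
  forall x y, a <= x <= b -> c <= y <= d -> flux_free x y.

Lemma flux_free_slices a b c d : flux_free_on a b c d ->
  (forall y, c <= y <= d -> continuous_on_seg (v ^~ y) a b) /\
  (forall x, a <= x <= b -> continuous_on_seg (u x) c d).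
Proof.
move=> h; split=> [y hy x|x hx y]; rewrite in_itv /=.
- move=> hx; have [al [be [ga he]]] := h x y hx hy.
  have [e e0 hd] := he 1 ltr01.
  apply: (@first_order_continuous _ _ ga 1) => //; exists e => // a' ha.
  have [_] := hd a' 0 ha ltac:(by rewrite normr0).
  by rewrite !addr0 mulr0 normr0 !addr0.
- move=> hy; have [al [be [ga he]]] := h x y hx hy.
  have [e e0 hd] := he 1 ltr01.
  apply: (@first_order_continuous _ _ be 1) => //; exists e => // a' ha.
  have [+ _] := hd 0 a' ltac:(by rewrite normr0) ha.
  by rewrite !addr0 mulr0 normr0 !add0r.
Qed.

Lemma flux_split_x a b c d e : flux_free_on a b c d -> c <= d ->
  a <= e -> e <= b -> flux a b c d = flux a e c d + flux e b c d.
Proof.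
move=> /flux_free_slices [hv _] cd ae eb; rewrite /flux.
rewrite (intg_split ae eb (hv d _)) ?cd ?lexx//.
rewrite (intg_split ae eb (hv c _)) ?cd ?lexx//; lra.
Qed.

Lemma flux_split_y a b c d e : flux_free_on a b c d -> a <= b ->
  c <= e -> e <= d -> flux a b c d = flux a b c e + flux a b e d.
Proof.
move=> /flux_free_slices [_ hu] ab ce ed; rewrite /flux.
rewrite (intg_split ce ed (hu a _)) ?ab ?lexx//.
rewrite (intg_split ce ed (hu b _)) ?ab ?lexx//; lra.
Qed.

Lemma flux_free_sub a b c d a' b' c' d' : a <= a' -> b' <= b -> c <= c' ->
  d' <= d -> flux_free_on a b c d -> flux_free_on a' b' c' d'.
Proof.
move=> ha hb hc hd h x y /andP[h1 h2] /andP[h3 h4]; apply: h; apply/andP; split;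
  lra.
Qed.

(** On a rectangle where the pair is nearly affine the flux is small relative
    to the area: the affine part contributes [v_y - u_x] times the area, that
    is, nothing. *)
Lemma flux_small x y w h a c (al be ga eps : R) :
  0 <= w -> 0 <= h -> flux_free_on a (a + w) c (c + h) ->
  (forall x' y', a <= x' <= a + w -> c <= y' <= c + h ->
     `|u x' y' - u x y - (al * (x' - x) + be * (y' - y))| <= eps /\
     `|v x' y' - v x y - (ga * (x' - x) + al * (y' - y))| <= eps) ->
  `|flux a (a + w) c (c + h)| <= 2 * eps * (w + h).
Proof.
move=> w0 h0 hff hs; have [hv hu] := flux_free_slices hff.
have e1 : a <= a + w by rewrite lerDl.
have e2 : c <= c + h by rewrite lerDl.
have cB (f g : R -> R) p q : continuous_on_seg f p q -> continuous_on_seg g p q ->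
    continuous_on_seg (fun x => f x - g x) p q.
  by move=> cf cg z zpq; apply: cvgB; [exact: cf|exact: cg].
have := @intg_near_cst _ (fun x => v x (c + h) - v x c) (al * h) (2 * eps) a (a + w) e1.
rewrite [a + w - a]addrC addKr => h1.
have := @intg_near_cst _ (fun y => u (a + w) y - u a y) (al * w) (2 * eps) c (c + h) e2.
rewrite [c + h - c]addrC addKr => h2.
have ina : a <= a <= a + w by rewrite e1 lexx.
have inaw : a <= a + w <= a + w by rewrite e1 lexx.
have inc : c <= c <= c + h by rewrite e2 lexx.
have inch : c <= c + h <= c + h by rewrite e2 lexx.
rewrite /flux -(intgB (hv _ inch) (hv _ inc)) -(intgB (hu _ inaw) (hu _ ina)).
have {}h1 := h1 (cB _ _ _ _ (hv _ inch) (hv _ inc)).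
have {}h2 := h2 (cB _ _ _ _ (hu _ inaw) (hu _ ina)).
have k1' : forall x0 : R, a <= x0 <= a + w ->
    `|v x0 (c + h) - v x0 c - al * h| <= 2 * eps.
  move=> x0 hx0.
  have [_] := hs x0 (c + h) hx0 inch.
  have [_] := hs x0 c hx0 inc.
  rewrite !ler_norml => /andP[k1 k2] /andP[k3 k4]; apply/andP; split; lra.
have k2' : forall y0 : R, c <= y0 <= c + h ->
    `|u (a + w) y0 - u a y0 - al * w| <= 2 * eps.
  move=> y0 hy0.
  have [+ _] := hs (a + w) y0 inaw hy0.
  have [+ _] := hs a y0 ina hy0.
  rewrite !ler_norml => /andP[k1 k2] /andP[k3 k4]; apply/andP; split; lra.
move: (h1 k1') (h2 k2'); rewrite !ler_norml => /andP[k1 k2] /andP[k3 k4].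
apply/andP; split; lra.
Qed.

Lemma flux_quarter a c w h K : 0 <= w -> 0 <= h ->
  flux_free_on a (a + w) c (c + h) -> K <= `|flux a (a + w) c (c + h)| ->
  exists a' c', [/\ a <= a', a' + w / 2 <= a + w, c <= c', c' + h / 2 <= c + h &
    K / 4 <= `|flux a' (a' + w / 2) c' (c' + h / 2)|].
Proof.
move=> w0 h0 hff hK.
have e1 : a + w = a + w / 2 + w / 2 by rewrite -addrA -splitr.
have e2 : c + h = c + h / 2 + h / 2 by rewrite -addrA -splitr.
have w20 : 0 <= w / 2 by rewrite divr_ge0.
have h20 : 0 <= h / 2 by rewrite divr_ge0.
have aw : a <= a + w / 2 by rewrite lerDl.
have aw' : a + w / 2 <= a + w by rewrite e1 lerDl.
have ch : c <= c + h / 2 by rewrite lerDl.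
have ch' : c + h / 2 <= c + h by rewrite e2 lerDl.
have sx := flux_split_x hff (le_trans ch ch') aw aw'.
have sy1 := flux_split_y (flux_free_sub (lexx a) aw' (lexx c) (lexx _) hff) aw ch ch'.
have sy2 := flux_split_y (flux_free_sub aw (lexx _) (lexx c) (lexx _) hff) aw' ch ch'.
pose f1 := flux a (a + w / 2) c (c + h / 2).
pose f2 := flux a (a + w / 2) (c + h / 2) (c + h).
pose f3 := flux (a + w / 2) (a + w) c (c + h / 2).
pose f4 := flux (a + w / 2) (a + w) (c + h / 2) (c + h).
have tot : K <= `|f1| + `|f2| + `|f3| + `|f4|.
  apply: le_trans hK _; rewrite sx sy1 sy2 -/f1 -/f2 -/f3 -/f4.
  rewrite addrA; apply: le_trans (ler_normD _ _) _; rewrite lerD2r.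
  by apply: le_trans (ler_normD _ _) _; rewrite lerD2r ler_normD.
have [q1|q1] := leP (K / 4) `|f1|; first by exists a, c; split.
have [q2|q2] := leP (K / 4) `|f2|.
  by exists a, (c + h / 2); split; rewrite -?e2.
have [q3|q3] := leP (K / 4) `|f3|.
  by exists (a + w / 2), c; split; rewrite -?e1.
have [q4|q4] := leP (K / 4) `|f4|.
  by exists (a + w / 2), (c + h / 2); split; rewrite -?e1 -?e2.
clear -tot q1 q2 q3 q4; lra.
Qed.

Lemma nested_rectangles a c w h K : 0 <= w -> 0 <= h ->
  flux_free_on a (a + w) c (c + h) -> K <= `|flux a (a + w) c (c + h)| ->
  exists s : nat -> R * R, s 0%N = (a, c) /\ forall n,
   [/\ (s n).1 <= (s n.+1).1,
       (s n.+1).1 + w / 2 ^+ n.+1 <= (s n).1 + w / 2 ^+ n,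
       (s n).2 <= (s n.+1).2,
       (s n.+1).2 + h / 2 ^+ n.+1 <= (s n).2 + h / 2 ^+ n
     & K / 4 ^+ n <= `|flux (s n).1 ((s n).1 + w / 2 ^+ n)
                            (s n).2 ((s n).2 + h / 2 ^+ n)|].
Proof.
move=> w0 h0 hff hK.
pose good (n : nat) (s : R * R) :=
  [/\ a <= s.1, s.1 + w / 2 ^+ n <= a + w, c <= s.2, s.2 + h / 2 ^+ n <= c + h
     & K / 4 ^+ n <= `|flux s.1 (s.1 + w / 2 ^+ n) s.2 (s.2 + h / 2 ^+ n)|].
pose next (n : nat) (s s' : R * R) :=
   [/\ s.1 <= s'.1, s'.1 + w / 2 ^+ n.+1 <= s.1 + w / 2 ^+ n,
       s.2 <= s'.2, s'.2 + h / 2 ^+ n.+1 <= s.2 + h / 2 ^+ n & good n.+1 s'].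
have step n s : exists s', good n s -> next n s s'.
  have [[g1 g2 g3 g4 g5]|ng] := pselect (good n s); last first.
    by exists s => /ng.
  have w1 : 0 <= w / 2 ^+ n by rewrite divr_ge0 // exprn_ge0.
  have h1 : 0 <= h / 2 ^+ n by rewrite divr_ge0 // exprn_ge0.
  have [a' [c' [q1 q2 q3 q4 q5]]] :=
    flux_quarter w1 h1 (flux_free_sub g1 g2 g3 g4 hff) g5.
  have ew : w / 2 ^+ n.+1 = w / 2 ^+ n / 2 by rewrite exprSr invfM mulrA.
  have eh : h / 2 ^+ n.+1 = h / 2 ^+ n / 2 by rewrite exprSr invfM mulrA.
  have eK : K / 4 ^+ n.+1 = K / 4 ^+ n / 4 by rewrite exprSr invfM mulrA.
  exists (a', c') => _; rewrite /next /good ew eh eK /=; split=> //; split => //;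
    lra.
pose nx n s := projT1 (cid (step n s)).
pose s := fix s n := if n is m.+1 then nx m (s m) else (a, c).
have gs n : good n (s n).
  elim: n => [|n ih]; first by rewrite /good /= !expr0 !divr1; split.
  by have [] := projT2 (cid (step n (s n))) ih.
exists s; split => // n.
have [n1 n2 n3 n4 _] := projT2 (cid (step n (s n))) (gs n).
by have [_ _ _ _ n5] := gs n; split.
Qed.

Lemma nested_point (l : nat -> R) (w : R) : 0 <= w ->
  (forall n, l n <= l n.+1) ->
  (forall n, l n.+1 + w / 2 ^+ n.+1 <= l n + w / 2 ^+ n) ->
  exists x, forall n, l n <= x <= l n + w / 2 ^+ n.
Proof.
move=> w0 lu ld.
have lum m n : (m <= n)%N -> l m <= l n.
  by move=> /subnK <-; elim: (n - m)%N => // k ih; rewrite addSn (le_trans ih).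
have ldm m n : (m <= n)%N -> l n + w / 2 ^+ n <= l m + w / 2 ^+ m.
  by move=> /subnK <-; elim: (n - m)%N => // k; rewrite addSn; exact: le_trans.
have wn n : 0 <= w / 2 ^+ n by rewrite divr_ge0 // exprn_ge0.
have ub n : ubound (range l) (l n + w / 2 ^+ n).
  move=> _ [m _ <-]; have [mn|/ltnW nm] := leqP m n.
    by rewrite (le_trans (lum _ _ mn)) // lerDl.
  by rewrite (le_trans _ (ldm _ _ nm)) // lerDl.
have hs : has_sup (range l).
  by split; [exists (l 0%N), 0%N | exists (l 0%N + w / 2 ^+ 0%N); exact: ub].
exists (sup (range l)) => n; apply/andP; split.
  by apply: (ub_le_sup hs.2); exists n.
exact: (ge_sup hs.1 (ub n)).
Qed.

(** Goursat's bisection. A nonzero flux [K] would leave flux at least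
    [K / 4 ^ n] through rectangles of side proportional to [2 ^ - n] shrinking
    to a point, where the first-order expansion bounds it by [o (4 ^ - n)]. *)
Theorem flux_eq0 a b c d : a <= b -> c <= d -> flux_free_on a b c d ->
  flux a b c d = 0.
Proof.
move=> ab cd; set w := b - a; set h := d - c.
have -> : b = a + w by rewrite /w addrC subrK.
have -> : d = c + h by rewrite /h addrC subrK.
have w0 : 0 <= w by rewrite subr_ge0.
have h0 : 0 <= h by rewrite subr_ge0.
move=> hff; pose K := `|flux a (a + w) c (c + h)|.
suff : K <= 0 by rewrite normr_le0 => /eqP.
have [s [s0 hs]] := nested_rectangles w0 h0 hff (lexx K).
have [x hx] : exists x, forall n, (s n).1 <= x <= (s n).1 + w / 2 ^+ n.
  by apply: nested_point => // n; have [] := hs n.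
have [y hy] : exists y, forall n, (s n).2 <= y <= (s n).2 + h / 2 ^+ n.
  by apply: nested_point => // n; have [] := hs n.
have sub n : [/\ a <= (s n).1, (s n).1 + w / 2 ^+ n <= a + w, c <= (s n).2
    & (s n).2 + h / 2 ^+ n <= c + h].
  elim: n => [|n [i1 i2 i3 i4]]; first by rewrite s0 /= !expr0 !divr1.
  have [j1 j2 j3 j4 _] := hs n; split; lra.
apply/ler_addgt0Pr => e e0; rewrite add0r.
pose S := 2 * (w + h) ^+ 2 + 1.
have S0 : 0 < S by rewrite ltr_wpDl // mulr_ge0 // sqr_ge0.
have xin : a <= x <= a + w by have := hx 0%N; rewrite s0 /= expr0 divr1.
have yin : c <= y <= c + h by have := hy 0%N; rewrite s0 /= expr0 divr1.
have [al [be [ga hd]]] := hff x y xin yin.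
have [dl dl0 {}hd] := hd (e / S) (divr_gt0 e0 S0).
have [n hn] : exists n, (w + h) / 2 ^+ n < dl.
  have [n hn] : exists n : nat, (w + h) / dl < n%:R.
    by exists (Num.truncn ((w + h) / dl)).+1; exact: truncnS_gt.
  exists n; rewrite ltr_pdivrMr ?exprn_gt0 // mulrC -ltr_pdivrMr //.
  apply: lt_le_trans hn _; rewrite -natrX ler_nat; exact: ltnW (ltn_expl _ _).
pose W := w / 2 ^+ n; pose H := h / 2 ^+ n.
have [i1 i2 i3 i4] := sub n.
have W0 : 0 <= W by rewrite divr_ge0 // exprn_ge0.
have H0 : 0 <= H by rewrite divr_ge0 // exprn_ge0.
have WH : W + H = (w + h) / 2 ^+ n by rewrite mulrDl.
have := @flux_small x y W H (s n).1 (s n).2 al be ga (e / S * (W + H)) W0 H0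
  (flux_free_sub i1 i2 i3 i4 hff).
have [_ _ _ _ hK] := hs n => hsm.
have {}hsm := le_trans hK (hsm _).
have {hsm} : K / 4 ^+ n <= 2 * (e / S * (W + H)) * (W + H).
  apply: hsm => x' y' /andP[p1 p2] /andP[p3 p4].
  have /andP[q1 q2] := hx n; have /andP[q3 q4] := hy n.
  rewrite -/W in p2 q2; rewrite -/H in p4 q4.
  have ax : `|x' - x| <= W by rewrite ler_norml; apply/andP; split; lra.
  have ay : `|y' - y| <= H by rewrite ler_norml; apply/andP; split; lra.
  have := hd (x' - x) (y' - y) ltac:(lra) ltac:(lra).
  rewrite ![_ + (_ - _)]addrC !subrK.
  have eS : 0 <= e / S by rewrite ltW // divr_gt0.
  have bd : e / S * (`|x' - x| + `|y' - y|) <= e / S * (W + H).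
    by rewrite ler_wpM2l // lerD.
  by move=> [r1 r2]; split; exact: le_trans bd.
have -> : 2 * (e / S * (W + H)) * (W + H) = (e * (2 * (w + h) ^+ 2) / S) / 4 ^+ n.
  rewrite WH -(_ : 2 ^+ n * 2 ^+ n = 4 ^+ n :> R); last first.
    by rewrite -exprMn -natrM.
  have := gt_eqF S0; have : 2 ^+ n != 0 :> R by rewrite expf_neq0.
  by move=> t0 t1; field; rewrite t0 t1.
rewrite ler_pM2r ?invr_gt0 ?exprn_gt0 // => hh; apply: le_trans hh _.
by rewrite ler_pdivrMr // ler_pM2l // /S lerDl.
Qed.


End Green.

(** * The mean value inequality *)

Section MeanValue.
Variable R : realType.
Local Notation C := R[i].
Implicit Types (f : C -> C) (z : C) (s t : R).

Lemma first_order_at0 (g : R -> R) (l : R) : is_derive (0 : R) 1 g l ->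
  forall eps, 0 < eps -> exists2 d : R, 0 < d & forall a, `|a| < d ->
    `|g a - g 0 - l * a| <= eps * `|a|.
Proof.
move=> [/cvg_ex[l' hl'] <-] e e0.
have <- : l' = 'D_1 g 0 by rewrite /derive; apply/esym; exact: cvg_lim hl'.
move/cvgrPdist_lt: hl' => /(_ e e0); rewrite /dnbhs/within/= => /nbhs_ballP[d d0 hd].
exists d => // a ad; have [->|a0] := eqVneq a 0.
  by rewrite mulr0 !subr0 subrr normr0 mulr0.
have := hd a; rewrite /ball /= sub0r normrN => /(_ ad a0) /ltW.
rewrite /GRing.scale /= mulr1 addr0 => h.
have -> : g a - g 0 - l' * a = - ((l' - a^-1 * (g a - g 0)) * a).
  by rewrite mulrBl mulrAC mulVf // mul1r opprB.
by rewrite normrN normrM ler_wpM2r.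
Qed.

Definition cexp s t : C := (expR s * cos t) +i* (expR s * sin t).

Lemma cexpD s t a b : cexp (s + a) (t + b) = cexp s t * cexp a b.
Proof.
apply: ReIm_inj; rewrite ?ReM ?ImM /= expRD ?cosD ?sinD; ring.
Qed.

Lemma cmod_cexp s t : cmod (cexp s t) = expR s.
Proof.
apply/eqP; rewrite -(eqrXn2 (n := 2)) ?cmod_ge0 ?expR_ge0 //; apply/eqP.
by rewrite sqr_cmod /= !exprMn -mulrDr cos2Dsin2 mulr1.
Qed.

Lemma cexp_first_order eps : 0 < eps -> exists2 d : R, 0 < d &
  forall a b, `|a| < d -> `|b| < d ->
   cmod (cexp a b - 1 - (a +i* b)) <= eps * (`|a| + `|b|).
Proof.
move=> e0.
pose e := Num.min (eps / 8) 1.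
have e1 : 0 < e by rewrite lt_min ltr01 andbT divr_gt0.
have ee : e <= eps / 8 by rewrite ge_min lexx.
have e11 : e <= 1 by rewrite ge_min lexx orbT.
clearbody e.
have [d1 d10 h1] := first_order_at0 (is_derive_expR 0) e1.
have [d2 d20 h2] := first_order_at0 (is_derive_cos 0) e1.
have [d3 d30 h3] := first_order_at0 (is_derive_sin 0) e1.
exists (Num.min (Num.min d1 d2) (Num.min d3 e)).
  by rewrite !lt_min d10 d20 d30 e1.
move=> a b; rewrite !lt_min => /andP[/andP[a1 a2] /andP[a3 a4]].
move=> /andP[/andP[b1 b2] /andP[b3 b4]].
have := h1 a a1; rewrite expR0 mul1r => {}h1.
have := h2 b b2; rewrite cos0 sin0 oppr0 mul0r subr0 => {}h2.
have := h3 b b3; rewrite cos0 sin0 mul1r subr0 => {}h3.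
have E2 : expR a <= 3.
  move: h1; rewrite ler_norml => /andP[_ k].
  have : e * `|a| <= 1 * 1 by apply: ler_pM => //; lra.
  have := ler_norm a; lra.
have E0 := expR_ge0 a.
apply: le_trans (cmod_le_ReIm _) _.
rewrite !ReB !ImB /= subr0.
have -> : expR a * cos b - 1 - a = expR a * (cos b - 1) + (expR a - 1 - a) by ring.
have -> : expR a * sin b - b = expR a * (sin b - b) + b * (expR a - 1 - a) + b * a.
  by ring.
have n1 : `|expR a * (cos b - 1)| <= 3 * (e * `|b|).
  by rewrite normrM ger0_norm // ler_pM.
have n2 : `|expR a * (sin b - b)| <= 3 * (e * `|b|).
  by rewrite normrM ger0_norm // ler_pM.
have n3 : `|b * (expR a - 1 - a)| <= e * `|a|.
  rewrite normrM; apply: le_trans (_ : 1 * (e * `|a|) <= _); last by rewrite mul1r.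
  by rewrite ler_pM // ltW // (lt_le_trans b4).
have n4 : `|b * a| <= e * `|a| by rewrite normrM ler_wpM2r // ltW.
have m1 := ler_normD (expR a * (cos b - 1)) (expR a - 1 - a).
have m2 := ler_normD (expR a * (sin b - b) + b * (expR a - 1 - a)) (b * a).
have m3 := ler_normD (expR a * (sin b - b)) (b * (expR a - 1 - a)).
have na := normr_ge0 a; have nb := normr_ge0 b.
have f1 : e * `|a| <= eps / 8 * `|a| by rewrite ler_wpM2r.
have f2 : e * `|b| <= eps / 8 * `|b| by rewrite ler_wpM2r.
have f3 : 0 <= eps * `|a| by rewrite mulr_ge0 // ltW.
have f4 : 0 <= eps * `|b| by rewrite mulr_ge0 // ltW.
have f5 : eps / 8 * `|a| = (eps * `|a|) / 8 by rewrite mulrAC.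
have f6 : eps / 8 * `|b| = (eps * `|b|) / 8 by rewrite mulrAC.
rewrite [leRHS]mulrDr; lra.
Qed.

(** Logarithmic polar coordinates around [z0] amount to composing [f] with the
    exponential, and the composite is again complex differentiable. *)
Lemma log_polar_flux_free f z0 l s t : cdiff f (z0 + cexp s t) l ->
  flux_free (fun s t => complex.Re (f (z0 + cexp s t)))
            (fun s t => complex.Im (f (z0 + cexp s t))) s t.
Proof.
move=> hf; set c := cexp s t; pose m := l * c.
exists (complex.Re m), (- complex.Im m), (complex.Im m) => e e0.
pose E := expR s; have E0 : 0 < E by exact: expR_gt0.
have cE : cmod c = E by exact: cmod_cexp.
have l0 := cmod_ge0 l.
pose e1 := e / (4 * E); have e10 : 0 < e1 by rewrite divr_gt0 // mulr_gt0.
pose e2 := Num.min 1 (e / (2 * E * (cmod l + 1))).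
have e20 : 0 < e2.
  by rewrite lt_min ltr01 divr_gt0 // !mulr_gt0 // ltr_wpDl.
have [d1 d10 h1] := hf e1 e10.
have [d2 d20 h2] := cexp_first_order e20.
exists (Num.min d2 (d1 / (4 * E))).
  by rewrite lt_min d20 divr_gt0 // mulr_gt0.
move=> a b; rewrite !lt_min => /andP[a1 a2] /andP[b1 b2].
pose k := c * (cexp a b - 1).
pose rho := cexp a b - 1 - (a +i* b).
have hrho : cmod rho <= e2 * (`|a| + `|b|) := h2 a b a1 b1.
pose N := `|a| + `|b|; have N0 : 0 <= N by rewrite addr_ge0.
have e21 : e2 <= 1 by rewrite ge_min lexx.
have hk : cmod k <= E * (2 * N).
  rewrite cmodM cE ler_wpM2l ?(ltW E0) //.
  have -> : cexp a b - 1 = rho + (a +i* b) by rewrite subrK.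
  apply: le_trans (cmodD _ _) _.
  have := cmod_le_ReIm (a +i* b) => /= h3.
  have : e2 * N <= 1 * N by rewrite ler_wpM2r.
  rewrite -/N in hrho h3; lra.
have kd : cmod k < d1.
  apply: le_lt_trans hk _.
  have : N < d1 / (4 * E) + d1 / (4 * E) by rewrite ltrD.
  have -> : d1 / (4 * E) + d1 / (4 * E) = d1 / E / 2.
    by field; rewrite gt_eqF.
  move=> h; have : 2 * N < d1 / E by lra.
  by rewrite ltr_pdivlMr // mulrC.
have herr := h1 k kd.
have -> : z0 + cexp (s + a) (t + b) = z0 + c + k.
  by rewrite cexpD -/c /k mulrBr mulr1 -addrA; congr (_ + _); rewrite addrC subrK.
set err := f _ - _ - _ in herr.
have fE : f (z0 + c + k) = f (z0 + c) + m * (a +i* b) + (err + m * rho).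
  rewrite /err /m /rho /k; ring.
have hm : cmod (err + m * rho) <= e * N.
  apply: le_trans (cmodD _ _) _.
  have q1 : cmod err <= e / 2 * N.
    apply: le_trans herr _; apply: le_trans (_ : e1 * (E * (2 * N)) <= _).
      by rewrite ler_wpM2l // ltW.
    rewrite le_eqVlt; apply/orP; left; apply/eqP; rewrite /e1; field.
    by rewrite gt_eqF.
  have q2 : cmod (m * rho) <= e / 2 * N.
    rewrite cmodM cmodM cE; apply: le_trans (_ : (cmod l + 1) * E * (e2 * N) <= _).
      by rewrite ler_pM ?mulr_ge0 ?cmod_ge0 ?(ltW E0) // ler_wpM2r ?(ltW E0) // lerDl.
    rewrite mulrA ler_wpM2r //.
    apply: le_trans (_ : (cmod l + 1) * E * (e / (2 * E * (cmod l + 1))) <= _).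
      rewrite ler_wpM2l ?mulr_ge0 ?(ltW E0) ?addr_ge0 //.
      by rewrite ge_min lexx orbT.
    rewrite le_eqVlt; apply/orP; left; apply/eqP; field.
    by rewrite !gt_eqF // ltr_wpDl.
  lra.
clearbody err.
rewrite /= fE !ReD !ImD.
have -> : complex.Re (m * (a +i* b)) = complex.Re m * a - complex.Im m * b by rewrite ReM.
have -> : complex.Im (m * (a +i* b)) = complex.Re m * b + complex.Im m * a by rewrite ImM.
split.
- rewrite [X in `|X|](_ : _ = complex.Re (err + m * rho)); last by rewrite ReD; ring.
  exact: le_trans (norm_Re_cmod _) hm.
- rewrite [X in `|X|](_ : _ = complex.Im (err + m * rho)); last by rewrite ImD; ring.
  exact: le_trans (norm_Im_cmod _) hm.
Qed.


Definition intg_polar f z0 s :=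
  intg (fun t => complex.Re (f (z0 + cexp s t))) 0 (pi *+ 2).

(** By periodicity the two radial sides of the rectangle of the [(s, t)] with
    [s1 <= s <= s2] and [0 <= t <= 2 pi] carry opposite flux, so that the other
    two sides, which are the circular means, balance. *)
Lemma intg_polar_cst f z0 s1 s2 : s1 <= s2 ->
  (forall s t, s <= s2 -> exists l, cdiff f (z0 + cexp s t) l) ->
  intg_polar f z0 s1 = intg_polar f z0 s2.
Proof.
move=> s12 hf; have pi0 : 0 <= (pi : R) *+ 2 by rewrite mulrn_wge0 // pi_ge0.
have : flux_free_on (fun s t => complex.Re (f (z0 + cexp s t)))
    (fun s t => complex.Im (f (z0 + cexp s t))) s1 s2 0 (pi *+ 2).
  move=> s t /andP[_ ss2] _; have [l hl] := hf s t ss2.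
  exact: log_polar_flux_free hl.
move=> /(flux_eq0 s12 pi0); rewrite /flux.
have -> : (fun s => complex.Im (f (z0 + cexp s (pi *+ 2)))) =
          (fun s => complex.Im (f (z0 + cexp s 0))).
  by apply/funext => s; rewrite /cexp -[pi *+ 2]add0r cosD2pi sinD2pi.
rewrite subrr sub0r => /eqP; rewrite oppr_eq0 subr_eq0 => /eqP.
by move=> h; rewrite /intg_polar h.
Qed.

(** Mean value inequality. At the centre only continuity is assumed, so that it
    applies to difference quotients at their removable singularity. *)
Theorem mean_value_le f z0 (rho r B : R) : 0 < r < rho ->
  (forall z, 0 < cmod (z - z0) < rho -> exists l, cdiff f z l) ->
  continuous_at_C f z0 ->
  (forall z, cmod (z - z0) = r -> complex.Re (f z) <= B) ->
  complex.Re (f z0) <= B.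
Proof.
move=> /andP[r0 rrho] hd hc hB; apply/ler_addgt0Pr => e e0.
have [d d0 {}hc] := hc e e0.
(* [s1] is the logarithm of a radius so small that continuity at [z0] controls
   the mean. *)
pose s2 := ln r; pose s1 := Num.min s2 (ln (d / 2)).
have d20 : 0 < d / 2 by rewrite divr_gt0.
have Es2 : expR s2 = r by rewrite lnK.
have s12 : s1 <= s2 by rewrite ge_min lexx.
have Es1 : expR s1 < d.
  apply: le_lt_trans (_ : expR (ln (d / 2)) < _).
    by rewrite ler_expR ge_min lexx orbT.
  by rewrite lnK //; lra.
have hcd s t : s <= s2 -> exists l, cdiff f (z0 + cexp s t) l.
  move=> ss; apply: hd; rewrite [z0 + _]addrC addrK cmod_cexp expR_gt0 /=.
  by apply: le_lt_trans rrho; rewrite -Es2 ler_expR.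
have pi0 : 0 < (pi : R) *+ 2 by rewrite pmulrn_lgt0 ?pi_gt0.
have cs s : s <= s2 ->
    continuous_on_seg (fun t => complex.Re (f (z0 + cexp s t))) 0 (pi *+ 2).
  move=> ss; have : flux_free_on (fun s t => complex.Re (f (z0 + cexp s t)))
      (fun s t => complex.Im (f (z0 + cexp s t))) s s 0 (pi *+ 2).
    move=> s' t /andP[_ ss2] _; have [l hl] := hcd s' t (le_trans ss2 ss).
    exact: log_polar_flux_free hl.
  by move=> /flux_free_slices [_]; apply; rewrite lexx.
have i2 : intg_polar f z0 s2 <= B * (pi *+ 2).
  rewrite -[pi *+ 2]subr0 -intg_cst ?subr0 ?(ltW pi0) //; apply: le_intg.
  - exact: cs.
  - by move=> x _; exact: cvg_cst.
  - by move=> t _; apply: hB; rewrite [z0 + _]addrC addrK cmod_cexp.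
have := @intg_near_cst _ _ (complex.Re (f z0)) e 0 (pi *+ 2) (ltW pi0) (cs _ s12).
rewrite -/(intg_polar f z0 s1) (intg_polar_cst s12 hcd) subr0 => i1.
have {}i1 : `|intg_polar f z0 s2 - complex.Re (f z0) * (pi *+ 2)| <= e * (pi *+ 2).
  apply: i1 => t _; rewrite -ReB; apply: le_trans (norm_Re_cmod _) _.
  by apply/ltW/hc; rewrite [z0 + _]addrC addrK cmod_cexp.
rewrite -(ler_pM2r pi0) mulrDl.
move: i1; rewrite ler_norml => /andP[i1 _]; lra.
Qed.

End MeanValue.

(** * The maximum principle *)

Section MaximumPrinciple.
Variable R : realType.
Local Notation C := R[i].
Implicit Types (f : C -> C) (z w : C) (K D : set C).

Lemma compact_bounded_closed K (M : R) :
  (forall z, K z -> cmod z <= M) -> closed K -> compact K.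
Proof.
move=> Kb Kc; pose g (q : R * R) : C := q.1 +i* q.2.
pose Q := `[- M, M]%classic `*` `[- M, M]%classic : set (R * R).
have cQ : compact Q by apply: compact_setX; exact: segment_compact.
have cg : continuous g.
  move=> q; apply/cvg_cmod => e e0.
  have e20 : 0 < e / 2 by rewrite divr_gt0.
  have h1 : \forall q' \near q, `|q'.1 - q.1| < e / 2.
    by apply: (@cvgr_distC_lt _ _ _ (nbhs q) _ (@fst R R)) => //; exact: cvg_fst.
  have h2 : \forall q' \near q, `|q'.2 - q.2| < e / 2.
    by apply: (@cvgr_distC_lt _ _ _ (nbhs q) _ (@snd R R)) => //; exact: cvg_snd.
  near=> q'; apply: le_lt_trans (cmod_le_ReIm _) _ => /=.
  have : `|q'.1 - q.1| < e / 2 by near: q'.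
  have : `|q'.2 - q.2| < e / 2 by near: q'.
  lra.
have cgQ : compact (g @` Q).
  by apply: continuous_compact cQ; exact: continuous_subspaceT.
apply: subclosed_compact Kc cgQ _ => z Kz; exists (complex.Re z, complex.Im z).
  have := Kb z Kz; have := norm_Re_cmod z; have := norm_Im_cmod z.
  by split; rewrite /= in_itv /= -ler_norml; lra.
by case: (z).
Unshelve. all: by end_near. Qed.

Lemma cdiff_add_affine f z l a b : cdiff f z l ->
  cdiff (fun w => f w + a * (w - b)) z (l + a).
Proof.
move=> h e e0; have [d d0 hd] := h e e0; exists d => // k kd.
rewrite (_ : _ - _ - _ = f (z + k) - f z - l * k); first exact: hd.
ring.
Qed.

Lemma continuous_add_affine f z a b : continuous_at_C f z ->
  continuous_at_C (fun w => f w + a * (w - b)) z.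
Proof.
move=> h e e0; have e20 : 0 < e / 2 by rewrite divr_gt0.
have [d d0 hd] := h (e / 2) e20.
pose m := cmod a + 1; have m0 : 0 < m by rewrite ltr_wpDl // cmod_ge0.
exists (Num.min d (e / 2 / m)); first by rewrite lt_min d0 divr_gt0.
move=> w; rewrite lt_min => /andP[h1 h2].
rewrite (_ : _ - _ = f w - f z + a * (w - z)); last by ring.
apply: le_lt_trans (cmodD _ _) _; rewrite cmodM.
have := hd w h1; have : cmod a * cmod (w - z) <= m * cmod (w - z).
  by rewrite ler_wpM2r ?cmod_ge0 // lerDl.
by move: h2; rewrite ltr_pdivlMr // mulrC; lra.
Qed.

(** Adding [e * |z| ^ 2] makes [Re f] strictly subharmonic; at an interior
    maximum the mean value inequality, applied to [f] corrected by the linear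
    part of that term, is then violated by [e * r ^ 2]. *)
Theorem Re_maximum_principle K D (M : R) f (B : R) :
  (forall z, K z -> cmod z <= M) -> closed K ->
  (forall z, K z -> continuous_at_C f z) ->
  (forall z, D z -> exists2 rho : R, 0 < rho & forall w, cmod (w - z) < rho ->
     K w /\ (w != z -> exists l, cdiff f w l)) ->
  (forall z, K z -> ~ D z -> complex.Re (f z) <= B) ->
  forall z, K z -> complex.Re (f z) <= B.
Proof.
move=> Kb Kc fc Dint hB z0 Kz0; apply/ler_addgt0Pr => e' e'0.
pose e := e' / (M ^+ 2 + 1).
have M1 : 0 < M ^+ 2 + 1 by rewrite ltr_wpDl // sqr_ge0.
have e0 : 0 < e by rewrite divr_gt0.
pose phi z := complex.Re (f z) + e * cmod z ^+ 2.
have K0 : K !=set0 by exists z0.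
have cphi : {within K, continuous phi}.
  apply: continuous_in_subspaceT => z /[!inE] Kz.
  apply: (@continuousD _ _ _ (fun z => complex.Re (f z)) (fun z => e * cmod z ^+ 2)).
    apply/(@cvgrPdist_lt _ _ _ (nbhs z) _) => /= eps eps0; apply/nbhs_cmod.
    have [d d0 hd] := fc z Kz eps eps0; exists d => // w /hd h.
    by rewrite -ReB; apply: le_lt_trans (norm_Re_cmod _) _; rewrite cmodB.
  have cc : {for z, continuous (@cmod R)}.
    apply/(@cvgrPdist_lt _ _ _ (nbhs z) _) => /= eps eps0; apply/nbhs_cmod; exists eps => // w wz.
    have := cmodD (z - w) w; have := cmodD (w - z) z; rewrite !subrK.
    move: wz; rewrite [cmod (z - w)]cmodB => wz h1 h2.
    rewrite ltr_norml; apply/andP; split; lra.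
  apply: (@continuousM _ _ (fun=> e) (fun z => cmod z ^+ 2)).
    exact: cst_continuous.
  exact: (@continuousM _ _ (@cmod R) (@cmod R)).
have [zs Kzs zsmax] := compact_EVT_max K0 (compact_bounded_closed Kb Kc) cphi.
rewrite inE in Kzs.
have {}zsmax z : K z -> phi z <= phi zs by move=> Kz; apply: zsmax; rewrite inE.
have phile : phi z0 <= phi zs by exact: zsmax.
have [Dz|nDz] := pselect (D zs); last first.
  have q1 : e * cmod zs ^+ 2 <= e * (M ^+ 2 + 1).
    rewrite ler_wpM2l ?(ltW e0) //; apply: le_trans (_ : M ^+ 2 <= _).
      rewrite ler_sqr ?nnegrE ?cmod_ge0 ?Kb //.
      exact: le_trans (cmod_ge0 zs) (Kb _ Kzs).
    by rewrite lerDl.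
  have q2 : e * (M ^+ 2 + 1) = e' by rewrite divfK // gt_eqF.
  have q3 : 0 <= e * cmod z0 ^+ 2 by rewrite mulr_ge0 ?sqr_ge0 // ltW.
  have := hB zs Kzs nDz.
  rewrite /phi in phile; lra.
have [rho rho0 hrho] := Dint zs Dz.
pose g w := f w + (2 * e)%:C * zs^* * (w - zs).
pose r := rho / 2.
have r0 : 0 < r by rewrite divr_gt0.
have gzs : complex.Re (g zs) = complex.Re (f zs) by rewrite /g subrr mulr0 addr0.
suff : complex.Re (g zs) <= complex.Re (f zs) - e * r ^+ 2.
  have : 0 < e * r ^+ 2 by rewrite mulr_gt0 // exprn_gt0.
  rewrite gzs; lra.
apply: (@mean_value_le _ g zs rho r).
- by rewrite r0 /r; lra.
- move=> w /andP[w0 wr]; have [_ /(_ _)[|l hl]] := hrho w wr.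
    by apply: contraTneq w0 => ->; rewrite subrr cmod0 ltxx.
  by exists (l + (2 * e)%:C * zs^*); exact: cdiff_add_affine.
- exact/continuous_add_affine/fc.
move=> w wr; have [Kw _] := hrho w ltac:(rewrite wr /r; lra).
have := zsmax w Kw; rewrite /phi /g.
have : cmod (w - zs) ^+ 2 = r ^+ 2 by rewrite wr.
rewrite !sqr_cmod !ReD !ReM !ImM !ReD !ImD !ReN !ImN ReJ ImJ /=.
move=> <- h; nra.
Qed.

End MaximumPrinciple.

(** * The Schwarz-Pick inequality of the half-plane *)

Section SchwarzPick.
Variable R : realType.
Local Notation C := R[i].
Implicit Types (f G : C -> C) (z w : C).

Lemma RHP_gt0 z : RHP z <-> 0 < complex.Re z.
Proof. by []. Qed.

Lemma RHP_addJ_neq0 z w : RHP z -> RHP w -> z + w^* != 0.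
Proof.
rewrite !RHP_gt0 => z0 w0; apply: contraTneq (addr_gt0 z0 w0) => h.
by rewrite -[complex.Re w]ReJ -ReD h ltxx.
Qed.

Lemma sqr_cmodDJ z w :
  cmod (z + w^*) ^+ 2 = cmod (z - w) ^+ 2 + 4 * (complex.Re z * complex.Re w).
Proof. rewrite !sqr_cmod !ReD !ImD ReN ImN ReJ ImJ; ring. Qed.

Lemma cmodJ z : cmod z^* = cmod z.
Proof. by rewrite !cmodE ReJ ImJ sqrrN. Qed.

Lemma cdiff_scale f z l a : cmod a <= 1 -> cdiff f z l ->
  cdiff (fun w => a * f w) z (a * l).
Proof.
move=> a1 h e e0; have [d d0 hd] := h e e0; exists d => // k kd.
rewrite (_ : _ - _ - _ = a * (f (z + k) - f z - l * k)); last by ring.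
rewrite cmodM; apply: le_trans (hd k kd).
by rewrite ler_piMl ?cmod_ge0.
Qed.

Lemma continuous_scale f z a : cmod a <= 1 -> continuous_at_C f z ->
  continuous_at_C (fun w => a * f w) z.
Proof.
move=> a1 h e e0; have [d d0 hd] := h e e0; exists d => // w wd.
rewrite -mulrBr cmodM; apply: le_lt_trans (hd w wd).
by rewrite ler_piMl ?cmod_ge0.
Qed.

Lemma continuous_extend_quotient (q s : C -> C) w l :
  (forall eps, 0 < eps -> exists2 d : R, 0 < d &
    forall z, z != w -> cmod (z - w) < d -> cmod (q z - l) <= eps) ->
  continuous_at_C s w ->
  continuous_at_C (fun z => if z == w then l * s w else q z * s z) w.
Proof.
move=> hq hs e e0.
pose m := cmod l + cmod (s w) + 1.
have l0 := cmod_ge0 l; have s0 := cmod_ge0 (s w).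
have m0 : 0 < m by rewrite /m; lra.
pose e1 := Num.min 1 (e / (2 * m)).
have e10 : 0 < e1 by rewrite lt_min ltr01 divr_gt0 // mulr_gt0.
have e1m : e1 <= e / (2 * m) by rewrite ge_min lexx orbT.
have e11 : e1 <= 1 by rewrite ge_min lexx.
clearbody e1.
have [d1 d10 h1] := hq e1 e10.
have [d2 d20 h2] := hs e1 e10.
exists (Num.min d1 d2); first by rewrite lt_min d10.
move=> z; rewrite lt_min => /andP[z1 z2]; rewrite /= eqxx.
have [_|zw] := eqVneq z w; first by rewrite subrr cmod0.
have {}h1 := h1 z zw z1; have {}h2 := h2 z z2.
rewrite (_ : _ - _ = (q z - l) * s z + l * (s z - s w)); last by ring.
apply: le_lt_trans (cmodD _ _) _; rewrite !cmodM.
have h3 : cmod (s z) <= cmod (s w) + 1.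
  by have := cmodD (s z - s w) (s w); rewrite subrK; lra.
have h4 : cmod (q z - l) * cmod (s z) <= e1 * (cmod (s w) + 1).
  by rewrite ler_pM ?cmod_ge0.
have h5 : cmod l * cmod (s z - s w) <= cmod l * e1.
  by rewrite ler_wpM2l // ltW.
have h6 : e1 * m <= e / 2.
  apply: le_trans (_ : e / (2 * m) * m <= _); first by rewrite ler_wpM2r // ltW.
  by rewrite le_eqVlt; apply/orP; left; apply/eqP; field; rewrite gt_eqF.
have : e1 * m = e1 * (cmod (s w) + 1) + cmod l * e1 by rewrite /m; ring.
lra.
Qed.

Section Disc.
Variables (w : C) (r : R).
Hypotheses (w0 : RHP w) (r0 : 0 < r) (r1 : r < 1).

(** The pseudo-hyperbolic disc of centre [w] and radius [r] in the half-plane. *)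
Definition hdisc : set C := [set z | cmod (z - w) <= r * cmod (z + w^*)].
Definition hdisc_open : set C := [set z | cmod (z - w) < r * cmod (z + w^*)].

Lemma hdisc_RHP_bounded z : hdisc z ->
  RHP z /\ cmod z <= 4 * complex.Re w / (1 - r ^+ 2) + cmod w.
Proof.
rewrite /hdisc /= => hz; have A0 := cmod_ge0 (z + w^*).
have w1 : 0 < complex.Re w := w0.
have r2 : 0 < 1 - r ^+ 2 by rewrite subr_gt0 expr_lt1 // ltW.
have h1 : (1 - r ^+ 2) * cmod (z + w^*) ^+ 2 <= 4 * (complex.Re z * complex.Re w).
  have : cmod (z - w) ^+ 2 <= (r * cmod (z + w^*)) ^+ 2.
    by rewrite ler_sqr ?nnegrE ?mulr_ge0 ?cmod_ge0 // ltW.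
  rewrite exprMn mulrBl mul1r => h; rewrite [X in X - _]sqr_cmodDJ; lra.
have z0 : 0 <= complex.Re z.
  rewrite leNgt; apply/negP => zn.
  have : complex.Re z * complex.Re w < 0 by rewrite nmulr_rlt0.
  have : 0 <= (1 - r ^+ 2) * cmod (z + w^*) ^+ 2 by rewrite mulr_ge0 ?sqr_ge0 // ltW.
  lra.
have zw : complex.Re z + complex.Re w <= cmod (z + w^*).
  by rewrite -[complex.Re w]ReJ -ReD Re_cmod.
have A1 : 0 < cmod (z + w^*) by lra.
have h2 : (1 - r ^+ 2) * cmod (z + w^*) <= 4 * complex.Re w.
  rewrite -(ler_pM2r A1) -mulrA -expr2; apply: le_trans h1 _.
  rewrite -mulrA ler_wpM2l // mulrC ler_wpM2l ?(ltW w1) //; lra.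
split.
  rewrite /RHP /= lt_neqAle z0 andbT eq_sym; apply: contraTneq h1 => ->.
  by rewrite mul0r mulr0 -ltNge mulr_gt0 // exprn_gt0.
have -> : z = (z + w^*) + - w^* by rewrite addrK.
apply: le_trans (cmodD _ _) _; rewrite cmodN cmodJ lerD2r.
by rewrite ler_pdivlMr // mulrC.
Qed.

Lemma hdisc_lip z z' :
  cmod (z' - w) <= cmod (z - w) + cmod (z' - z) /\
  r * cmod (z' + w^*) <= r * cmod (z + w^*) + cmod (z' - z).
Proof.
split.
  by rewrite [leRHS]addrC -(subrKA z z') cmodD.
apply: le_trans (_ : r * (cmod (z + w^*) + cmod (z' - z)) <= _).
  rewrite ler_wpM2l ?(ltW r0) // (_ : z' + w^* = (z + w^*) + (z' - z)) ?cmodD //.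
  by ring.
by rewrite mulrDr lerD2l ler_piMl ?cmod_ge0 // ltW.
Qed.

Lemma hdisc_closed : closed hdisc.
Proof.
rewrite -openC openE => z /= /negP; rewrite -ltNge => hz.
apply/nbhs_cmod.
exists ((cmod (z - w) - r * cmod (z + w^*)) / 2); first by rewrite divr_gt0 // subr_gt0.
move=> z' zz'; rewrite /setC /hdisc /=; apply/negP; rewrite -ltNge.
have [h1 _] := hdisc_lip z' z; have [_ h2] := hdisc_lip z z'.
rewrite [cmod (z - z')]cmodB in h1; lra.
Qed.

Lemma hdisc_interior z : hdisc_open z -> exists2 rho : R, 0 < rho &
  forall z', cmod (z' - z) < rho -> hdisc z'.
Proof.
rewrite /hdisc_open /= => hz.
exists ((r * cmod (z + w^*) - cmod (z - w)) / 2); first by rewrite divr_gt0 // subr_gt0.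
move=> z' zz'; rewrite /hdisc /=.
have [h1 _] := hdisc_lip z z'; have [_ h2] := hdisc_lip z' z.
rewrite [cmod (z - z')]cmodB in h2; lra.
Qed.

End Disc.

(** The Schwarz lemma, transported to the half-plane. Let [k] be the quotient of
    the Moebius coordinate [(G z - G w) / (G z + (G w)^* )] by
    [(z - w) / (z + w^* )]. On the boundary of the disc of radius [r] it is at
    most [1 / r] in modulus, because the first is at most [1] and the second
    equal to [r] there; the
    maximum principle spreads this to the disc, and then [r] tends to [1]. *)
Lemma schwarz_quotient G w : holomorphic_self_map G -> RHP w ->
  forall z, RHP z -> z != w ->
  cmod (G z - G w) * cmod (z + w^*) <= cmod (G z + (G w)^*) * cmod (z - w).
Proof.
move=> [hG Gp] w0 z0 z0p z0w.
have [l hl] := derivable_cdiff (hG w w0).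
pose s z := (z + w^*) / (G z + (G w)^*).
pose q z := (G z - G w) / (z - w).
pose k z := if z == w then l * s w else q z * s z.
have Gn z : RHP z -> G z + (G w)^* != 0.
  by move=> hz; apply: RHP_addJ_neq0; exact: Gp.
have ds z : RHP z -> derivable s z 1.
  move=> hz; apply: derivableM.
    by apply: derivableD; [exact: derivable_id|exact: derivable_cst].
  apply: derivableV; first exact: Gn.
  by apply: derivableD; [exact: hG|exact: derivable_cst].
have dk z : RHP z -> z != w -> derivable k z 1.
  move=> hz zw; apply: (@near_eq_derivable _ _ _ (q * s)).
    apply/nbhs_cmod; exists (cmod (z - w)); first by rewrite cmod_gt0 // subr_eq0.
    move=> z' hz'; rewrite /k; case: eqP => // zw'.
    by rewrite zw' cmodB ltxx in hz'.
  apply: derivableM (ds z hz); apply: derivableM.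
    by apply: derivableB; [exact: hG|exact: derivable_cst].
  apply: derivableV; first by rewrite subr_eq0.
  by apply: derivableB; [exact: derivable_id|exact: derivable_cst].
have ck z : RHP z -> continuous_at_C k z.
  move=> hz; have [->|zw] := eqVneq z w; last first.
    by have [l' hl'] := derivable_cdiff (dk z hz zw); exact: cdiff_continuous hl'.
  apply: continuous_extend_quotient; last first.
    by have [l' hl'] := derivable_cdiff (ds w w0); exact: cdiff_continuous hl'.
  move=> e e0; have [d d0 hd] := hl e e0; exists d => // z' z'w z'd.
  have zn : z' - w != 0 by rewrite subr_eq0.
  have := hd _ z'd; rewrite [w + _]addrC subrK.
  have -> : G z' - G w - l * (z' - w) = (q z' - l) * (z' - w).
    by rewrite /q mulrBl divfK.
  by rewrite cmodM ler_pM2r // cmod_gt0.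
have main r : 0 < r -> r < 1 -> hdisc w r z0 -> cmod (k z0) <= r^-1.
  move=> r0 r1 hz0; have [k0|k0] := eqVneq (k z0) 0.
    by rewrite k0 cmod0 invr_ge0 ltW.
  (* The rotation [c] makes [c * k z0] real, so that a bound on real
     parts becomes a bound on the modulus. *)
  pose c := (k z0)^* / (cmod (k z0))%:C.
  have c1 : cmod c <= 1.
    by rewrite cmodM cmodV cmod_real cmodJ ger0_norm ?cmod_ge0 // divff // gt_eqF // cmod_gt0.
  have cE : complex.Re (c * k z0) = cmod (k z0).
    have n0 : cmod (k z0) != 0 by rewrite gt_eqF // cmod_gt0.
    rewrite /c -mulrA mulrCA mulrC.
    have -> : (k z0)^* * k z0 = ((cmod (k z0)) ^+ 2)%:C.
      rewrite sqr_cmod; apply: ReIm_inj; rewrite ?ReM ?ImM ReJ ImJ /=; ring.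
    by rewrite -fmorphV -rmorphM /= expr2 mulfK.
  rewrite -cE; apply: (@Re_maximum_principle _ (hdisc w r) (hdisc_open w r)
    (4 * complex.Re w / (1 - r ^+ 2) + cmod w) (fun z => c * k z)) => //.
  - by move=> z /(hdisc_RHP_bounded w0 r0 r1) [].
  - exact: hdisc_closed.
  - by move=> z /(hdisc_RHP_bounded w0 r0 r1) [/ck h _]; exact: continuous_scale.
  - move=> z /(hdisc_interior r0 r1)[rho rho0 hrho].
    have cd z' : cmod (z' - z) < rho -> z' != w -> exists l, cdiff (fun z => c * k z) z' l.
      move=> hz' z'w; have [z'p _] := hdisc_RHP_bounded w0 r0 r1 (hrho z' hz').
      have [l' hl'] := derivable_cdiff (dk z' z'p z'w).
      by exists (c * l'); exact: cdiff_scale.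
    have [zw|zw] := eqVneq z w.
      by exists rho => // z' hz'; split; [exact: hrho | rewrite zw => /(cd z' hz')].
    exists (Num.min rho (cmod (z - w))).
      by rewrite lt_min rho0 cmod_gt0 // subr_eq0.
    move=> z'; rewrite lt_min => /andP[h1 h2]; split; first exact: hrho.
    move=> _; apply: cd => //; apply: contraTneq h2 => ->.
    by rewrite cmodB ltxx.
  move=> z hz nz; apply: le_trans (Re_cmod _) _; rewrite cmodM.
  have [zp _] := hdisc_RHP_bounded w0 r0 r1 hz.
  have A0 : 0 < cmod (z + w^*) by rewrite cmod_gt0 // RHP_addJ_neq0.
  have zr : cmod (z - w) = r * cmod (z + w^*).
    apply/eqP; rewrite eq_le; apply/andP; split; first exact: hz.
    by rewrite leNgt; apply/negP.
  have zw : z != w.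
    apply: contra_eqN zr => /eqP ->.
    by rewrite subrr cmod0 lt_eqF // mulr_gt0 // cmod_gt0 // RHP_addJ_neq0.
  rewrite -[leRHS]mul1r ler_pM ?cmod_ge0 //.
  rewrite /k (negbTE zw) /q /s !cmodM !cmodV zr.
  have B0 : 0 < cmod (G z + (G w)^*) by rewrite cmod_gt0 // Gn.
  rewrite (_ : _ * _ = cmod (G z - G w) / cmod (G z + (G w)^*) * r^-1); last first.
    by field; rewrite !gt_eqF.
  rewrite ler_piMl ?invr_ge0 ?(ltW r0) // ler_pdivrMr // mul1r.
  rewrite -ler_sqr ?nnegrE ?cmod_ge0 // sqr_cmodDJ lerDl.
  by rewrite mulr_ge0 // mulr_ge0 // ltW //; exact: Gp.
have B0 : 0 < cmod (G z0 + (G w)^*) by rewrite cmod_gt0 // Gn.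
have A0 : 0 < cmod (z0 + w^*) by rewrite cmod_gt0 // RHP_addJ_neq0.
have C0 : 0 < cmod (z0 - w) by rewrite cmod_gt0 // subr_eq0.
have kz : cmod (k z0) <= 1.
  rewrite leNgt; apply/negP => k1.
  pose rho := cmod (z0 - w) / cmod (z0 + w^*).
  have rho1 : rho < 1.
    rewrite ltr_pdivrMr // mul1r -ltr_sqr ?nnegrE ?cmod_ge0 // sqr_cmodDJ ltrDl.
    by rewrite mulr_gt0 // mulr_gt0.
  (* Any radius between [rho] and [1] with [1 / r < cmod (k z0)] will do. *)
  pose r := Num.max rho (2 / (1 + cmod (k z0))).
  have X0 : 0 < 1 + cmod (k z0) by lra.
  have r0 : 0 < r by rewrite lt_max divr_gt0 ?orbT.
  have r1 : r < 1 by rewrite gt_max rho1 ltr_pdivrMr // mul1r; lra.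
  have : cmod (k z0) <= r^-1.
    apply: main => //; rewrite /hdisc /= -ler_pdivrMr //.
    by rewrite le_max lexx.
  have : r^-1 <= (2 / (1 + cmod (k z0)))^-1.
    by rewrite lef_pV2 ?posrE ?divr_gt0 // le_max lexx orbT.
  rewrite invf_div; lra.
move: kz; rewrite /k (negbTE z0w) /q /s !cmodM !cmodV.
rewrite (_ : _ * _ = (cmod (G z0 - G w) * cmod (z0 + w^*)) /
   (cmod (G z0 + (G w)^*) * cmod (z0 - w))); last by field; rewrite !gt_eqF.
by rewrite ler_pdivrMr ?mulr_gt0 // mul1r.
Qed.

(** The invariant form of the Schwarz-Pick inequality. Unlike holomorphy it
    visibly passes to pointwise limits; this is how the generator, known only
    as a limit of difference quotients, comes to satisfy it. *)
Definition pick (H : C -> C) : Prop :=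
  (forall z, RHP z -> 0 <= complex.Re (H z)) /\
  forall z w, RHP z -> RHP w ->
    cmod (H z - H w) ^+ 2 * (complex.Re z * complex.Re w) <=
    complex.Re (H z) * complex.Re (H w) * cmod (z - w) ^+ 2.

(** Shifting by [eta > 0] puts the values into the open half-plane, where the
    Schwarz lemma applies; then [eta] tends to [0]. *)
Theorem schwarz_pick G : holomorphic_RHP G ->
  (forall z, RHP z -> 0 <= complex.Re (G z)) -> pick G.
Proof.
move=> hG G0; split => // z w hz hw.
have [->|zw] := eqVneq z w.
  by rewrite !subrr cmod0 expr0n mul0r mulr0.
have key (eta : R) : 0 < eta -> cmod (G z - G w) ^+ 2 * (complex.Re z * complex.Re w) <=
    (complex.Re (G z) + eta) * (complex.Re (G w) + eta) * cmod (z - w) ^+ 2.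
  move=> eta0; pose G' x := G x + eta%:C.
  have G'h : holomorphic_self_map G'.
    split=> [x hx|x hx].
      by apply: derivableD; [exact: hG|exact: derivable_cst].
    by rewrite /RHP /= ReD /= ltr_wpDl // G0.
  have := schwarz_quotient G'h hw hz zw.
  rewrite -ler_sqr ?nnegrE ?mulr_ge0 ?cmod_ge0 // !exprMn !sqr_cmodDJ.
  have -> : G' z - G' w = G z - G w by rewrite /G' opprD addrACA subrr addr0.
  rewrite /G' !ReD /=; set X := _ ^+ 2; set Y := cmod (z - w) ^+ 2; lra.
have a0 := G0 z hz; have b0 := G0 w hw.
set a := complex.Re (G z) in key a0 *; set b := complex.Re (G w) in key b0 *.
set d := cmod (z - w) ^+ 2 in key *.
have d0 : 0 <= d by rewrite sqr_ge0.
apply/ler_addgt0Pr => e e0.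
pose m := (a + b + 1) * d + 1.
have m0 : 0 < m by rewrite ltr_wpDl // mulr_ge0 // !addr_ge0.
pose eta := Num.min 1 (e / m).
have eta0 : 0 < eta by rewrite lt_min ltr01 divr_gt0.
have etam : eta <= e / m by rewrite ge_min lexx orbT.
have eta1 : eta <= 1 by rewrite ge_min lexx.
apply: le_trans (key eta eta0) _.
have h1 : eta * m <= e by rewrite -ler_pdivlMr.
have h2 : eta * eta * d <= eta * d.
  by rewrite ler_wpM2r // ler_piMl // ltW.
have h3 : eta * m = eta * a * d + eta * b * d + eta * d + eta by rewrite /m; ring.
have -> : (a + eta) * (b + eta) * d = a * b * d + (eta * a * d + eta * b * d + eta * eta * d).
  by ring.
lra.
Qed.

End SchwarzPick.

(** * Harnack, Julia and Wolff *)

Section JuliaWolff.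
Variable R : realType.
Local Notation C := R[i].
Implicit Types (G H : C -> C) (z w : C).

(** With [Re (H z) <= |H w| + |H z - H w|] the Schwarz-Pick inequality becomes a
    quadratic inequality for [|H z - H w|], solved here for [d <= 1]. *)
Lemma pick_harnack H (d : R) z w : pick H -> RHP z -> RHP w -> 0 <= d <= 1 ->
  cmod (z - w) ^+ 2 <= d ^+ 2 * (complex.Re z * complex.Re w) ->
  cmod (H z - H w) <= 2 * d * cmod (H w).
Proof.
move=> [H0 hP] z0 w0 /andP[d0 d1] zw.
have z1 : 0 < complex.Re z := z0; have w1 : 0 < complex.Re w := w0.
set D := cmod (H z - H w); set U := cmod (H w).
have D0 : 0 <= D := cmod_ge0 _; have U0 : 0 <= U := cmod_ge0 _.
have rz : complex.Re (H z) <= U + D.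
  have := Re_cmod (H z - H w); have := Re_cmod (H w); rewrite ReB -/D -/U; lra.
have rw : complex.Re (H w) <= U by exact: Re_cmod.
have h : D ^+ 2 <= d ^+ 2 * (U * (U + D)).
  have P0 : 0 < complex.Re z * complex.Re w by rewrite mulr_gt0.
  rewrite -(ler_pM2r P0); apply: le_trans (hP z w z0 w0) _.
  apply: le_trans (_ : ((U + D) * U) * (d ^+ 2 * (complex.Re z * complex.Re w)) <= _).
    apply: ler_pM => //; [by rewrite mulr_ge0 ?H0|exact: sqr_ge0|].
    by apply: ler_pM; rewrite ?H0 //; lra.
  by rewrite le_eqVlt; apply/orP; left; apply/eqP; ring.
rewrite leNgt; apply/negP => hD.
pose A := d * U; have A0 : 0 <= A by rewrite mulr_ge0.
have hA : 2 * A < D by move: hD; rewrite /A mulrA.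
have e1 : d ^+ 2 * (U * (U + D)) = A ^+ 2 + d * (A * D) by rewrite /A; ring.
have e2 : d * (A * D) <= A * D by rewrite ler_piMl // mulr_ge0.
nra.
Qed.

(** The minimum principle for [Re H]. *)
Lemma pick_rigid H z w : pick H -> RHP z -> RHP w -> complex.Re (H w) = 0 ->
  H z = H w.
Proof.
move=> [H0 hP] z0 w0 hw; have := hP z w z0 w0; rewrite hw mulr0 mul0r.
rewrite pmulr_lle0; last by rewrite mulr_gt0.
rewrite le_eqVlt ltNge sqr_ge0 orbF expf_eq0 /= => /eqP /cmod_eq0 /eqP.
by rewrite subr_eq0 => /eqP.
Qed.

(** Julia's lemma: comparing with a point where [Re H / Re z] is almost
    minimal shows that [H] is sublinear in every sector. *)
Theorem pick_julia H : pick H ->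
  (forall eps, 0 < eps -> exists2 z0, RHP z0 &
     complex.Re (H z0) <= eps * complex.Re z0) ->
  forall M eps : R, 0 < eps -> exists2 K : R, 0 <= K & forall z, RHP z ->
    cmod z <= M * complex.Re z -> K < cmod z -> cmod (H z) <= eps * cmod z.
Proof.
move=> pH hinf M eps eps0; have [H0 hP] := pH.
have M10 : 0 < `|M| + 1 by rewrite ltr_wpDl.
pose M1 := `|M| + 1.
have e10 : 0 < eps / (8 * M1) by rewrite divr_gt0 // mulr_gt0.
have [z0 z0p hz0] := hinf _ e10.
have c00 := cmod_ge0 (H z0).
exists (cmod z0 + 4 * cmod (H z0) / eps).
  by rewrite addr_ge0 ?cmod_ge0 // divr_ge0 ?mulr_ge0 ?(ltW eps0) //.
move=> z zp zM zK.
have z1 : 0 < complex.Re z := zp; have w1 : 0 < complex.Re z0 := z0p.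
have q0 : 0 <= 4 * cmod (H z0) / eps by rewrite divr_ge0 ?mulr_ge0 ?(ltW eps0) //.
have q1 : 4 * cmod (H z0) / eps < cmod z by have := cmod_ge0 z0; lra.
have {q1} zH : 4 * cmod (H z0) < eps * cmod z.
  by move: q1; rewrite ltr_pdivrMr // [ltRHS]mulrC.
have zz : cmod z0 < cmod z by lra.
have Z0 : 0 < cmod z by apply: le_lt_trans zz; exact: cmod_ge0.
have zM1 : cmod z <= M1 * complex.Re z.
  apply: le_trans zM _; rewrite ler_wpM2r ?(ltW z1) // /M1.
  by have := ler_norm M; lra.
set D := cmod (H z - H z0); have D0 : 0 <= D := cmod_ge0 _.
set U := cmod (H z0) in c00 zH q0 *.
set Z := cmod z in zK zH zz Z0 zM1 *.
pose E := eps / 2 * Z.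
have E0 : 0 < E by rewrite mulr_gt0 // divr_gt0.
have zd : cmod (z - z0) ^+ 2 <= 4 * Z ^+ 2.
  have h := cmodD z (- z0); rewrite cmodN in h.
  have -> : 4 * Z ^+ 2 = (2 * Z) ^+ 2 by ring.
  rewrite ler_sqr ?nnegrE ?cmod_ge0 ?mulr_ge0 ?(ltW Z0) //.
  rewrite -/Z in h; lra.
have h : D ^+ 2 <= (U + D) * E.
  have P0 : 0 < complex.Re z * complex.Re z0 by rewrite mulr_gt0.
  rewrite -(ler_pM2r P0); apply: le_trans (hP z z0 zp z0p) _.
  apply: le_trans (_ : ((U + D) * (eps / (8 * M1) * complex.Re z0)) * (4 * Z ^+ 2) <= _).
    apply: ler_pM => //; [by rewrite mulr_ge0 ?H0|exact: sqr_ge0|].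
    apply: ler_pM; rewrite ?H0 //.
    have := Re_cmod (H z - H z0); have := Re_cmod (H z0).
    by rewrite ReB -/D -/U; lra.
  apply: le_trans (_ : (U + D) * (eps / (8 * M1) * complex.Re z0) *
     (4 * (Z * (M1 * complex.Re z))) <= _).
    apply: ler_wpM2l; first by apply: mulr_ge0; [lra|apply: mulr_ge0; exact: ltW].
    by apply: ler_wpM2l => //; rewrite expr2; apply: ler_wpM2l => //; exact: ltW.
  rewrite le_eqVlt; apply/orP; left; apply/eqP; rewrite /E; field.
  by rewrite gt_eqF.
have DE : D <= U + E by rewrite leNgt; apply/negP => hD; nra.
have := cmodD (H z - H z0) (H z0); rewrite subrK -/D -/U => h2.
move: DE h2 zH; rewrite /E; lra.
Qed.

(** By [slope_angular] this infimum is the angular derivative of [G] at infinity,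
    that is, the angular limit of [G z / z]. *)
Definition slope G : R :=
  inf [set complex.Re (G z) / complex.Re z | z in RHP (R := R)].

Section Slope.
Variable G : C -> C.
Hypothesis hG : holomorphic_self_map G.

Let slope_lb : has_lbound
  [set complex.Re (G z) / complex.Re z | z in RHP (R := R)].
Proof.
exists 0 => _ [z zp <-]; rewrite divr_ge0 // ltW //; exact: hG.2.
Qed.

Let slope_nonempty :
  [set complex.Re (G z) / complex.Re z | z in RHP (R := R)] !=set0.
Proof. by exists (complex.Re (G 1) / complex.Re 1), 1 => //=; rewrite /RHP /=. Qed.

Lemma slope_le z : RHP z -> slope G * complex.Re z <= complex.Re (G z).
Proof.
move=> zp; rewrite -ler_pdivlMr //; apply: (ge_inf slope_lb).
by exists z.
Qed.

Lemma slope_ge (c : R) :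
  (forall z, RHP z -> c * complex.Re z <= complex.Re (G z)) -> c <= slope G.
Proof.
move=> h; apply: lb_le_inf => // _ [z zp <-].
by rewrite ler_pdivlMr // h.
Qed.

Lemma slope_adherent eps : 0 < eps -> exists2 z, RHP z &
  complex.Re (G z) <= (slope G + eps) * complex.Re z.
Proof.
move=> e0; have [_ [z zp <-] h] := inf_adherent e0 (conj slope_nonempty slope_lb).
by exists z => //; rewrite -ler_pdivrMr // ltW.
Qed.

(** The Julia-Wolff-Caratheodory theorem: [G z - slope G * z] still has
    nonnegative real part, and Julia's lemma applies to it. *)
Theorem slope_angular (M eps : R) : 0 < eps -> exists2 K : R, 0 <= K &
  forall z, RHP z -> cmod z <= M * complex.Re z -> K < cmod z ->
    cmod (G z - (slope G)%:C * z) <= eps * cmod z.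
Proof.
pose H z := G z - (slope G)%:C * z.
have ReH z : complex.Re (H z) = complex.Re (G z) - slope G * complex.Re z.
  by rewrite /H ReB ReM /= mul0r subr0.
apply: (@pick_julia H).
  apply: schwarz_pick.
    move=> z zp; apply: derivableB; first exact: hG.1.
    by apply: derivableM; [exact: derivable_cst|exact: derivable_id].
  by move=> z zp; rewrite ReH subr_ge0 slope_le.
move=> e e0; have [z zp hz] := slope_adherent e0; exists z => //.
by rewrite ReH; lra.
Qed.

End Slope.

(** The chain rule for angular derivatives. Along the real axis [G2 x] stays in a
    sector, since [Re (G2 x) >= slope G2 * x] while [|G2 x|] is about
    [slope G2 * x]; there [G1] may be replaced by its linear part. *)
Lemma slope_comp G1 G2 G12 : holomorphic_self_map G1 -> holomorphic_self_map G2 ->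
  holomorphic_self_map G12 -> eq_RHP (G1 \o G2) G12 ->
  0 < slope G1 -> 0 < slope G2 -> slope G12 = slope G1 * slope G2.
Proof.
move=> h1 h2 h12 e12 s1 s2; apply/eqP; rewrite eq_le; apply/andP; split; last first.
  apply: slope_ge => z zp; rewrite -e12 //=.
  have := slope_le h1 (h2.2 z zp); apply: le_trans.
  by rewrite -mulrA ler_wpM2l ?(ltW s1) // slope_le.
apply/ler_addgt0Pr => eps eps0.
pose m := slope G1 + slope G2 + 1.
have m0 : 0 < m by rewrite /m; lra.
pose e := Num.min 1 (eps / m).
have e0 : 0 < e by rewrite lt_min ltr01 divr_gt0.
have e1 : e <= 1 by rewrite ge_min lexx.
have em : e * m <= eps by rewrite -ler_pdivlMr // ge_min lexx orbT.
have [K2 K20 a2] := slope_angular h2 1 e0.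
have [K1 K10 a1] := slope_angular h1 ((slope G2 + e) / slope G2) e0.
pose x : R := K2 + K1 / slope G2 + 1.
have K1s : 0 <= K1 / slope G2 by rewrite divr_ge0 // ltW.
have x0 : 0 < x by rewrite /x; lra.
have xp : RHP (x%:C : C) by [].
have cx : cmod (x%:C : C) = x by rewrite cmod_real gtr0_norm.
have := a2 x%:C xp; rewrite cx /= mul1r => /(_ (lexx _) ltac:(rewrite /x; lra)) b2.
have yp := h2.2 _ xp; set y := G2 x%:C in b2 yp.
have y1 := slope_le h2 xp; rewrite -/y /= in y1.
have y2 : cmod y <= (slope G2 + e) * x.
  rewrite -(subrK ((slope G2)%:C * x%:C) y); apply: le_trans (cmodD _ _) _.
  rewrite cmodM cx cmod_real gtr0_norm // mulrDl; lra.
have y3 := Re_cmod y.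
have yM : cmod y <= (slope G2 + e) / slope G2 * complex.Re y.
  apply: le_trans y2 _; rewrite mulrAC -mulrA ler_wpM2l //; first lra.
  by rewrite ler_pdivlMr // mulrC.
have yK : K1 < cmod y.
  apply: lt_le_trans (le_trans y1 y3).
  by rewrite mulrC -ltr_pdivrMr // /x; lra.
have b1 := a1 y yp yM yK.
have := slope_le h12 xp; rewrite -e12 //= -/y => h.
have r1 : complex.Re (G1 y) <= slope G1 * cmod y + e * cmod y.
  have := Re_cmod (G1 y - (slope G1)%:C * y).
  rewrite ReB ReM /= mul0r subr0.
  have : slope G1 * complex.Re y <= slope G1 * cmod y by rewrite ler_wpM2l // ltW.
  lra.
have r2 : (slope G1 + e) * cmod y <= (slope G1 + e) * ((slope G2 + e) * x).
  by rewrite ler_wpM2l //; lra.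
rewrite -(ler_pM2r x0); apply: le_trans h _.
apply: le_trans (_ : (slope G1 + e) * ((slope G2 + e) * x) <= _); first lra.
rewrite mulrA ler_wpM2r ?(ltW x0) //.
have : e * e <= e by rewrite ler_piMl // ltW.
move: em; rewrite /m; nra.
Qed.

End JuliaWolff.

(** * Integrals on vertical lines and test functions *)

Section HardyNorm.
Variable R : realType.
Variable p : R.
Hypothesis p1 : 1 < p.
Local Notation C := R[i].
Implicit Types (phi : C -> C) (z w c : C).

Let p0 : 0 < p. Proof. exact: lt_trans ltr01 p1. Qed.

Definition line_integral phi (x : R) : \bar R :=
  (\int[lebesgue_measure]_y ((cmod (phi (x +i* y))) `^ p)%:E)%E.

Lemma line_integral_ge0 phi x : (0 <= line_integral phi x)%E.
Proof. by apply: integral_ge0 => y _; rewrite lee_fin powR_ge0. Qed.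

Lemma line_integral_le phi (K x : R) : 0 <= K -> (hardy_norm p phi <= K%:E)%E ->
  0 < x -> (line_integral phi x <= (pi * K `^ p)%:E)%E.
Proof.
move=> K0 hK x0.
have : (((pi^-1)%:E * line_integral phi x) `^ p^-1 <= K%:E)%E.
  by apply: le_trans hK; apply: ereal_sup_ubound; exists x.
have pi0 : 0 < (pi : R) := pi_gt0 R.
have := line_integral_ge0 phi x.
case: (line_integral phi x) => [l|_|//]; last first.
  by rewrite gt0_muley ?lte_fin ?invr_gt0 //= gt_eqF ?invr_gt0 // leye_eq.
rewrite lee_fin -EFinM poweR_EFin !lee_fin => l0 h.
have := ge0_ler_powR (ltW p0) _ _ h; rewrite !nnegrE => /(_ (powR_ge0 _ _) K0).
rewrite -powRrM mulVf ?gt_eqF // powRr1 ?mulr_ge0 ?invr_ge0 ?(ltW pi0) //.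
by rewrite ler_pdivrMl.
Qed.

Lemma hardy_norm_le1 phi : (forall x, 0 < x -> (line_integral phi x <= pi%:E)%E) ->
  (hardy_norm p phi <= 1)%E.
Proof.
move=> h; apply: ge_ereal_sup => _ [x x0 <-].
rewrite -/(line_integral phi x).
have pi0 : 0 < (pi : R) := pi_gt0 R.
have := line_integral_ge0 phi x; have := h x x0.
case: (line_integral phi x) => // l; rewrite !lee_fin => lpi l0.
apply: (@le_trans _ _ (1 `^ p^-1)); last by rewrite powR1.
rewrite ge0_ler_powR ?nnegrE ?invr_ge0 ?(ltW p0) ?mulr_ge0 ?invr_ge0 ?(ltW pi0) //.
by rewrite ler_pdivrMl // mulr1.
Qed.

Lemma continuous_vertical phi x : holomorphic_RHP phi -> 0 < x ->
  continuous (fun y : R => cmod (phi (x +i* y))).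
Proof.
move=> hphi x0 y; apply/(@cvgrPdist_lt _ _ _ (nbhs y)) => /= e e0.
have [l /cdiff_continuous hl] := derivable_cdiff (hphi (x +i* y) x0).
have [d d0 hd] := hl e e0.
near=> t.
have : cmod ((x +i* t) - (x +i* y)) < d.
  apply: le_lt_trans (cmod_le_ReIm _) _; rewrite ReB ImB /= subrr normr0 add0r.
  by rewrite distrC; near: t; exact: (nbhsx_ballx y).
move=> /hd; set a := phi _; set b := phi _ => ab.
have := cmodD (a - b) b; have := cmodD (b - a) a; rewrite !subrK.
rewrite [cmod (b - a)]cmodB => h1 h2.
rewrite ltr_norml; apply/andP; split; lra.
Unshelve. all: by end_near. Qed.

Lemma measurable_vertical phi x : holomorphic_RHP phi -> 0 < x ->
  measurable_fun [set: R] (EFin \o (fun y : R => (cmod (phi (x +i* y))) `^ p)).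
Proof.
move=> hphi x0; apply/measurable_EFinP.
have h : measurable_fun [set: R] (fun y : R => cmod (phi (x +i* y))).
  by apply: continuous_measurable_fun; exact: continuous_vertical.
exact: (measurableT_comp (measurable_powR p) h).
Qed.

Lemma line_integral_segment_le phi (x u v A B : R) : holomorphic_RHP phi ->
  0 < x -> u <= v -> 0 <= A -> (line_integral phi x <= B%:E)%E ->
  (forall y, u <= y <= v -> A <= cmod (phi (x +i* y))) ->
  A `^ p * (v - u) <= B.
Proof.
move=> hphi x0 uv A0 hB hA; rewrite -lee_fin; apply: le_trans hB.
apply: (@le_trans _ _ (\int[lebesgue_measure]_(y in `[u, v])
   ((cmod (phi (x +i* y))) `^ p)%:E)%E); last first.
  apply: ge0_subset_integral => //; first exact: measurable_vertical.
  by move=> y _; rewrite lee_fin powR_ge0.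
have <- : (\int[lebesgue_measure]_(y in `[u, v]) (A `^ p)%:E = (A `^ p * (v - u))%:E)%E.
  rewrite integral_cst //= lebesgue_measure_itv /= lte_fin.
  rewrite le_eqVlt in uv; case/predU1P: uv => [->|->].
    by rewrite ltxx mule0 subrr mulr0.
  by rewrite -EFinB -EFinM.
apply: ge0_le_integral => //.
- by move=> y _; rewrite lee_fin powR_ge0.
- by apply: measurable_funTS; exact: measurable_vertical.
move=> y /=; rewrite in_itv /= => /hA h; rewrite lee_fin.
by apply: ge0_ler_powR; rewrite ?nnegrE ?cmod_ge0 ?(ltW p0).
Qed.

(** The square of the Cauchy kernel with pole [- c], scaled to norm at most [1].
    With the square, the [p]-th power of the modulus on a vertical line is at
    most [pi] times the Poisson density of parameter [Re c] centred at [- Im c],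
    whatever [p >= 1]. *)
Definition kernel c z : C :=
  (complex.Re c ^+ 2 * complex.Re c `^ (- p^-1))%:C / (z + c) ^+ 2.

Lemma RHP_add_neq0 z c : RHP z -> 0 < complex.Re c -> z + c != 0.
Proof.
move=> z0 c0; rewrite -[c]conjcK; apply: RHP_addJ_neq0 => //.
by rewrite RHP_gt0 ReJ.
Qed.

Lemma kernel_holomorphic c : 0 < complex.Re c -> holomorphic_RHP (kernel c).
Proof.
move=> c0 z z0; apply: derivableM; first exact: derivable_cst.
have d1 : derivable (fun z : C => z + c) z 1.
  by apply: derivableD; [exact: derivable_id|exact: derivable_cst].
apply: derivableV; first by rewrite expf_neq0 // RHP_add_neq0.
exact: (derivableM d1 d1).
Qed.

Lemma cmod_kernel c z : 0 < complex.Re c ->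
  cmod (kernel c z) = complex.Re c ^+ 2 * complex.Re c `^ (- p^-1) / cmod (z + c) ^+ 2.
Proof.
move=> c0; rewrite /kernel cmodM cmodV cmod_real ger0_norm; last first.
  by rewrite mulr_ge0 ?powR_ge0 // sqr_ge0.
by rewrite [(z + c) ^+ 2]expr2 cmodM -[cmod _ * cmod _]expr2.
Qed.

Lemma integral_cauchy_density (r v : R) : 0 < r ->
  (\int[lebesgue_measure]_y (r^-1 * (oneDsqr (r^-1 * (y + v)))^-1)%:E = (pi : R)%:E)%E.
Proof.
move=> r0; pose G (s : R) := (oneDsqr s)^-1.
pose F (y : R) := r^-1 * (y + v).
have r'0 : 0 < r^-1 by rewrite invr_gt0.
have dF (y : R) : is_derive y 1 F r^-1.
  have h : is_derive y 1 (fun y : R => y + v) (1 + 0).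
    by apply: is_deriveD.
  have := is_deriveZ r^-1 h; rewrite addr0 /GRing.scale /= mulr1; exact.
have F' : derive1 F = cst r^-1.
  by apply/funext => y; rewrite derive1E; exact: derive_val.
have cG : continuous G by exact: continuous_oneDsqrV.
have G0 s : 0 <= G s by rewrite invr_ge0 (le_trans ler01) // oneDsqr_ge1.
have -> : (pi : R)%:E = (\int[lebesgue_measure]_s (G s)%:E)%E.
  rewrite ge0_symfun_integralT //; last by move=> s; rewrite /G /oneDsqr /= sqrrN.
  rewrite -set_itvcy integral0y_oneDsqr -EFinM; congr EFin; lra.
rewrite (@increasing_ge0_integration_by_substitutionT _ F G) //.
- by apply: eq_integral => y _; rewrite F' /= mulrC.
- by move=> a b ab; rewrite /F ltr_pM2l // ltrD2r.
- by rewrite F'; exact: cst_continuous.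
- by rewrite F'; exact: is_cvg_cst.
- by rewrite F'; exact: is_cvg_cst.
- apply/cvgrNyPle => A; near=> y; rewrite /F ler_pdivrMl //.
  by rewrite -lerBrDr; near: y; apply: nbhs_ninfty_le; rewrite num_real.
- apply/cvgryPge => A; near=> y; rewrite /F ler_pdivlMl //.
  by rewrite -lerBlDr; near: y; apply: nbhs_pinfty_ge; rewrite num_real.
Unshelve. all: by end_near. Qed.

Lemma kernel_le1 c : 0 < complex.Re c -> (hardy_norm p (kernel c) <= 1)%E.
Proof.
move=> c0; apply: hardy_norm_le1 => x x0.
set r := complex.Re c in c0 *; set v := complex.Im c.
rewrite -(integral_cauchy_density v c0); apply: ge0_le_integral => //.
- by move=> y _; rewrite lee_fin powR_ge0.
- exact: measurable_vertical (kernel_holomorphic c0) x0.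
- apply/measurable_EFinP; apply: continuous_measurable_fun => y.
  apply: (@continuousM _ _ (fun=> r^-1) (fun y => (oneDsqr (r^-1 * (y + v)))^-1)).
    exact: cst_continuous.
  apply: (@continuous_comp _ _ _ (fun y => r^-1 * (y + v)) (fun s => (oneDsqr s)^-1));
    last exact: continuous_oneDsqrV.
  apply: (@continuousM _ _ (fun=> r^-1) (fun y => y + v)).
    exact: cst_continuous.
  by apply: cvgD; [exact: cvg_id|exact: cvg_cst].
move=> y _; rewrite lee_fin cmod_kernel // -/r sqr_cmod ReD ImD /= -/r -/v.
set s := r^-1 * (y + v).
have ys : y + v = r * s by rewrite /s mulrA divff ?mul1r // gt_eqF.
have o1 : 1 <= oneDsqr s := oneDsqr_ge1 s.
have o0 : 0 < oneDsqr s by lra.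
have ov : 0 < (oneDsqr s)^-1 <= 1 by rewrite invr_gt0 o0 invf_le1.
apply: (@le_trans _ _ ((r `^ (- p^-1) * (oneDsqr s)^-1) `^ p)).
  apply: ge0_ler_powR; rewrite ?nnegrE ?(ltW p0) //.
  - apply: divr_ge0; first by rewrite mulr_ge0 ?powR_ge0 ?sqr_ge0.
    by rewrite addr_ge0 ?sqr_ge0.
  - by rewrite mulr_ge0 ?powR_ge0 // invr_ge0 ltW.
  have xr : r ^+ 2 * oneDsqr s <= (x + r) ^+ 2 + (y + v) ^+ 2.
    have : r ^+ 2 <= (x + r) ^+ 2 by rewrite ler_sqr ?nnegrE; lra.
    have -> : (y + v) ^+ 2 = r ^+ 2 * s ^+ 2 by rewrite ys exprMn.
    have -> : r ^+ 2 * oneDsqr s = r ^+ 2 + r ^+ 2 * s ^+ 2 by rewrite /oneDsqr; ring.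
    lra.
  rewrite mulrAC [leRHS]mulrC ler_wpM2r ?powR_ge0 //.
  rewrite ler_pdivrMr ?(lt_le_trans _ xr) ?mulr_gt0 ?exprn_gt0 //.
  by rewrite mulrC ler_pdivlMr.
rewrite powRM ?powR_ge0 ?invr_ge0 ?(ltW o0) // -powRrM mulNr mulVf ?gt_eqF //.
rewrite powR_inv1 ?(ltW c0) // ler_pM2l ?invr_gt0 //.
by apply: ge1r_powR => //; exact: ltW.
Qed.

Lemma kernel_hardy c : 0 < complex.Re c -> hardy p (kernel c).
Proof.
move=> c0; split; first exact: kernel_holomorphic.
by apply: le_lt_trans (kernel_le1 c0) _; rewrite ltry.
Qed.

End HardyNorm.

(** * Bounded composition operators *)

Section CompositionOperators.
Variable R : realType.
Variable p : R.
Hypothesis p1 : 1 < p.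
Local Notation C := R[i].
Implicit Types (phi psi : C -> C) (z w c : C) (G : C -> C).

Let p0 : 0 < p. Proof. exact: lt_trans ltr01 p1. Qed.

Lemma hardy_norm_ge0 phi : (0 <= hardy_norm p phi)%E.
Proof.
apply: le_trans (poweR_ge0 _ p^-1) _; apply: ereal_sup_ubound.
by exists 1; first exact: ltr01.
Qed.

Lemma bounded_line_integral (A : (C -> C) -> (C -> C)) : bounded_linear p A ->
  exists2 M : R, 0 <= M & forall phi x, hardy p phi -> (hardy_norm p phi <= 1)%E ->
    0 < x -> (line_integral p (A phi) x <= (pi * M `^ p)%:E)%E.
Proof.
move=> [_ _ [M hM]]; exists `|M| => // phi x hphi n1 x0.
apply: (line_integral_le p1) => //; apply: le_trans (hM phi hphi) _.
apply: le_trans (_ : (`|M|%:E * hardy_norm p phi <= _)%E).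
  by rewrite lee_wpmul2r ?hardy_norm_ge0 // lee_fin ler_norm.
by rewrite -[leRHS]mule1 lee_wpmul2l // lee_fin.
Qed.

Lemma powR_kernel_const (r k : R) : 0 < r -> 0 <= k ->
  (r `^ (- p^-1) * k) `^ p = r^-1 * k `^ p.
Proof.
move=> r0 k0; rewrite powRM ?powR_ge0 // -powRrM mulNr mulVf ?gt_eqF //.
by rewrite powR_inv1 // ltW.
Qed.

(** On the vertical segment of length [Re w] above [w], the map [G] stays within
    a fixed hyperbolic distance of [a = G w], where the kernel with pole
    [- a^* ] is comparable to its maximum. Integrating over that segment,
    boundedness gives [Re w <= K * Re (G w)] with [K] independent of [w]. *)
Lemma bounded_slope_gt0 G : holomorphic_self_map G ->
  bounded_linear p (fun phi => phi \o G) -> 0 < slope G.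
Proof.
move=> hG hB; have [M M0 hM] := bounded_line_integral hB.
have [hH _ _] := hB.
pose K := pi * M `^ p * 25 `^ p.
have K0 : 0 <= K by rewrite !mulr_ge0 ?powR_ge0 ?pi_ge0.
suff h w : RHP w -> complex.Re w <= K * complex.Re (G w).
  apply: (@lt_le_trans _ _ (K + 1)^-1); first by rewrite invr_gt0 ltr_wpDl.
  apply: slope_ge => // w w0; rewrite ler_pdivrMl ?ltr_wpDl //.
  apply: le_trans (h w w0) _; rewrite ler_wpM2r ?lerDl // ltW //; exact: hG.2.
move=> w0; set a := G w; have a0 : 0 < complex.Re a := hG.2 _ w0.
set r := complex.Re a in a0 *; set x := complex.Re w.
have x0 : 0 < x := w0.
have c0 : 0 < complex.Re a^* by rewrite ReJ.
have near y : complex.Im w <= y <= complex.Im w + x ->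
    cmod (G (x +i* y) + a^*) <= 5 * r.
  move=> /andP[y1 y2]; set z := x +i* y.
  have z0 : RHP z by rewrite /RHP.
  have := (schwarz_pick hG.1 (fun z hz => ltW (hG.2 z hz))).2 z w z0 w0.
  rewrite -/a -/r -/x [complex.Re z]/= => hP.
  have gz0 : 0 < complex.Re (G z) := hG.2 z z0.
  have zw : cmod (z - w) ^+ 2 <= x * x.
    rewrite sqr_cmod ReB ImB /= -/x subrr expr0n add0r -expr2 ler_sqr ?nnegrE; lra.
  have h1 : cmod (G z - a) ^+ 2 <= complex.Re (G z) * r.
    have xx : 0 < x * x by rewrite mulr_gt0.
    rewrite -(ler_pM2r xx); apply: le_trans hP _.
    by rewrite ler_wpM2l // mulr_ge0 // ltW.
  have := sqr_cmodDJ (G z) a; rewrite -/r.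
  have := Re_cmod (G z + a^*); rewrite ReD ReJ -/r.
  set A := cmod _ => h2 h3.
  have A0 : 0 < A by lra.
  rewrite -(ler_pM2l A0) -expr2 h3.
  have : complex.Re (G z) * r <= A * r by rewrite ler_wpM2r ?(ltW a0) //; lra.
  nra.
have hphi := kernel_hardy p1 c0; have nphi := kernel_le1 p1 c0.
have hol : holomorphic_RHP (kernel p a^* \o G) by have [] := hH _ hphi.
pose k := 25^-1 : R.
have := @line_integral_segment_le R p p1 _ x (complex.Im w) (complex.Im w + x)
  (r `^ (- p^-1) * k) _ hol x0 _ _ (hM _ x hphi nphi x0).
have xx : complex.Im w + x - complex.Im w = x by ring.
rewrite powR_kernel_const ?invr_ge0 // xx => main.
have : r^-1 * k `^ p * x <= pi * M `^ p.
  apply: main.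
  - by rewrite lerDl ltW.
  - by rewrite mulr_ge0 ?powR_ge0 // invr_ge0.
  move=> y /near hy; rewrite /= cmod_kernel // ReJ -/r.
  have A0 : 0 < cmod (G (x +i* y) + a^*).
    rewrite cmod_gt0 // RHP_addJ_neq0 //; exact: hG.2.
  rewrite mulrAC [leLHS]mulrC ler_wpM2r ?powR_ge0 //.
  rewrite ler_pdivlMr ?exprn_gt0 // /k ler_pdivrMl //.
  have -> : 25 * r ^+ 2 = (5 * r) ^+ 2 by ring.
  by rewrite ler_sqr ?nnegrE ?cmod_ge0 // mulr_ge0 // ltW.
have k0 : 0 < k `^ p by rewrite powR_gt0 // invr_gt0.
have -> : r^-1 * k `^ p * x = x * k `^ p / r by ring.
rewrite ler_pdivrMr // -ler_pdivlMr // => h; apply: le_trans h _.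
rewrite le_eqVlt; apply/orP; left; apply/eqP; rewrite /K.
have -> : (25 : R) `^ p = (k `^ p)^-1.
  by rewrite -powR_inv1 ?powR_ge0 // -powRrM mulrC powRrM powR_inv1 ?invr_ge0 // invrK.
by rewrite mulrAC.
Qed.

Lemma line_integral_sum_le psi e d (k x A B : R) :
  holomorphic_RHP psi -> holomorphic_RHP e -> holomorphic_RHP d -> 0 < x -> 0 <= k ->
  (forall z, RHP z -> cmod (psi z) <= k * (cmod (e z) + cmod (d z))) ->
  (line_integral p e x <= A%:E)%E -> (line_integral p d x <= B%:E)%E ->
  (line_integral p psi x <= ((2 * k) `^ p * (A + B))%:E)%E.
Proof.
move=> hpsi he hd x0 k0 hle hA hB.
have pw (f : C -> C) y : 0 <= cmod (f (x +i* y)) `^ p by rewrite powR_ge0.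
have k2 : 0 <= (2 * k) `^ p by rewrite powR_ge0.
apply: (@le_trans _ _ (((2 * k) `^ p)%:E * (line_integral p e x + line_integral p d x))%E);
  last by rewrite EFinM EFinD lee_wpmul2l ?lee_fin // leeD.
rewrite /line_integral -ge0_integralD //; last 4 first.
- by move=> y _; rewrite lee_fin.
- exact: measurable_vertical.
- by move=> y _; rewrite lee_fin.
- exact: measurable_vertical.
have ms : measurable_fun [set: R] (fun y : R =>
    ((cmod (e (x +i* y)) `^ p)%:E + (cmod (d (x +i* y)) `^ p)%:E)%E).
  by apply: emeasurable_funD; exact: measurable_vertical.
rewrite -ge0_integralZl //; last first.
  by move=> y _; rewrite -EFinD lee_fin addr_ge0.
apply: ge0_le_integral => //.
- by move=> y _; rewrite lee_fin.
- exact: measurable_vertical.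
- exact: measurable_funeM.
move=> y _; rewrite -EFinD -EFinM lee_fin.
have := hle (x +i* y) x0.
set a := cmod (e _); set b := cmod (d _).
have a0 : 0 <= a := cmod_ge0 _; have b0 : 0 <= b := cmod_ge0 _.
pose m := Num.max a b.
have m0 : 0 <= m by rewrite le_max a0.
move=> h; apply: (@le_trans _ _ ((2 * k * m) `^ p)).
  apply: ge0_ler_powR; rewrite ?nnegrE ?cmod_ge0 ?(ltW p0) ?mulr_ge0 //.
  apply: le_trans h _; rewrite (_ : 2 * k * m = k * (2 * m)) ?ler_wpM2l //; last by ring.
  have : a <= m by rewrite le_max lexx.
  have : b <= m by rewrite le_max lexx orbT.
  lra.
rewrite powRM ?mulr_ge0 // ler_wpM2l // /m.
by have [ab|ab] := leP a b; rewrite ?lerDl ?lerDr powR_ge0.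
Qed.

(** For small [h] the difference quotient of the extension at time [1] is within
    distance [1] of its derivative there in operator norm, hence bounded. *)
Lemma analytic_lipschitz (F : R -> C -> C) S th1 th2 :
  0 < th1 -> 0 < th2 ->
  (forall t, 0 <= t -> bounded_linear p (composition_semigroup F t)) ->
  analytic_extension p (composition_semigroup F) (sector th1 th2) S ->
  exists K d : R, [/\ 0 <= K, 0 < d & forall (h : R) phi (x : R), 0 < h < d -> hardy p phi ->
    (hardy_norm p phi <= 1)%E -> 0 < x ->
    (line_integral p (fun z => phi (F (1 + h)%R z) - phi (F 1 z))%R x <=
      (h `^ p * K)%:E)%E].
Proof.
move=> t1 t2 hT [Sb San St _ _].
have sreal (t : R) : 0 < t -> sector th1 th2 t%:C.
  move=> tp; exists t, 0; split => //; first by rewrite oppr_lt0.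
  by rewrite cos0 sin0 mulr1 mulr0.
have [D Db hD] := San 1%:C (sreal 1 ltr01).
have [M M0 hM] := bounded_line_integral Db.
have : \forall h \near (0 : C)^', (op_norm p (fun phi z =>
      ((S (1%:C + h) phi z - S 1%:C phi z) / h - D phi z)%R) <= 1)%E.
  have : nbhs (0%E : \bar R) [set e | (e <= 1)%E].
    have : nbhs (0 : R) [set r : R | r <= 1].
      apply/nbhs_ballP; exists 1 => [|r] /=; first exact: ltr01.
      by rewrite /ball /= sub0r normrN => h; rewrite (le_trans (ler_norm r)) // ltW.
    by apply: filterS => r; rewrite /= lee_fin.
  exact: hD.
move=> /nbhs_cmod [d d0 hd].
exists (2 `^ p * (pi + pi * M `^ p)), d; split => //.
  by rewrite mulr_ge0 ?powR_ge0 // addr_ge0 ?pi_ge0 // mulr_ge0 ?pi_ge0 ?powR_ge0.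
move=> h phi x /andP[h0 hlt] hphi nphi x0.
pose E z := (S (1%:C + h%:C) phi z - S 1%:C phi z) / h%:C - D phi z.
have hn0 : h%:C != 0 :> C by apply/eqP => /complexI /eqP; rewrite gt_eqF.
have nE : (hardy_norm p E <= 1)%E.
  apply: le_trans (hd h%:C _ hn0); last by rewrite subr0 cmod_real gtr0_norm.
  by apply: ereal_sup_ubound; exists phi.
have hol A : bounded_linear p A -> holomorphic_RHP (A phi).
  by move=> [hA _ _]; have [] := hA phi hphi.
have S1h : bounded_linear p (S (1%:C + h%:C)).
  by apply: Sb; rewrite -rmorphD; apply: sreal; rewrite addr_gt0.
have S1 : bounded_linear p (S 1%:C) by apply: Sb; exact: sreal.
have hE : holomorphic_RHP E.
  move=> z z0; apply: derivableB; last exact: hol.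
  apply: derivableM; last exact: derivable_cst.
  by apply: derivableB; exact: hol.
have iE : (line_integral p E x <= (pi * 1 `^ p)%:E)%E.
  by apply: line_integral_le.
rewrite powR1 mulr1 in iE.
have := @line_integral_sum_le (fun z => phi (F (1 + h) z) - phi (F 1 z)) E (D phi) h x
  _ _ _ hE (hol D Db) x0 (ltW h0) _ iE (hM phi x hphi nphi x0).
rewrite powRM ?(ltW h0) // [2 `^ p * _]mulrC -mulrA; apply.
- move=> z z0; apply: derivableB.
    by apply: (hol _ (hT (1 + h) _)) => //; rewrite addr_ge0 // ltW.
  by apply: (hol _ (hT 1 _)).
move=> z z0.
have e1 := St (1 + h) ltac:(by rewrite addr_gt0) phi hphi z z0.
have e2 := St 1 ltr01 phi hphi z z0.
rewrite /composition_semigroup /= in e1 e2; rewrite -e1 -e2 rmorphD.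
have -> : S (1%:C + h%:C) phi z - S 1%:C phi z = h%:C * (E z + D phi z).
  by rewrite /E subrK mulrC divfK.
by rewrite cmodM cmod_real gtr0_norm // ler_wpM2l ?(ltW h0) // cmodD.
Qed.

End CompositionOperators.

(** * The angular derivatives of the semigroup are one *)

Section AngularDerivativeOne.
Variable R : realType.
Variable p : R.
Hypothesis p1 : 1 < p.
Local Notation C := R[i].
Implicit Types (phi psi : C -> C) (z w c : C) (G : C -> C).

Let p0 : 0 < p. Proof. exact: lt_trans ltr01 p1. Qed.

(** Far out, on a scale [N], the two maps are close to the dilations by [s] and
    [s * b]. At height [N * m] with [m = 1 / |b - 1|] these move points apart by
    about [N * s], however close [b] is to [1]. The kernel with pole
    [- N * s * (1 - i m)] has that same width and is centred at that height, so
    it separates the two images by an amount comparable to its maximum. This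
    bounds the distance of the two composition operators from below, uniformly
    for [b] in a bounded set. *)
Lemma slope_gap G1 G2 (s b B L : R) : holomorphic_self_map G1 ->
  holomorphic_self_map G2 -> slope G1 = s -> slope G2 = s * b ->
  0 < s -> 0 < b -> b != 1 -> b <= B ->
  (forall phi, hardy p phi -> holomorphic_RHP (phi \o G1) /\ holomorphic_RHP (phi \o G2)) ->
  (forall phi x, 0 < x -> hardy p phi -> (hardy_norm p phi <= 1)%E ->
     (line_integral p (fun z => phi (G2 z) - phi (G1 z))%R x <= L%:E)%E) ->
  s^-1 * ((5 + 2 * B) ^- 4) `^ p <= L.
Proof.
move=> h1 h2 s1 s2 s0 b0 b1 bB hol hL.
pose m := `|b - 1|^-1; have bn : 0 < `|b - 1| by rewrite normr_gt0 subr_eq0.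
have m0 : 0 < m by rewrite invr_gt0.
have bm : `|b - 1| * m = 1 by rewrite divff // gt_eqF.
have M0 : 0 < m + 2 by lra.
pose eps := s / (4 * (m + 2)).
have eps0 : 0 < eps by rewrite divr_gt0 // mulr_gt0.
have [K1 K10 a1] := slope_angular h1 (m + 2) eps0.
have [K2 K20 a2] := slope_angular h2 (m + 2) eps0.
pose N := K1 + K2 + 1; have N0 : 0 < N by rewrite /N; lra.
pose r := N * s; have r0 : 0 < r by rewrite mulr_gt0.
pose c : C := r +i* (- (r * m)).
have c0 : 0 < complex.Re c by [].
pose W := 5 + 2 * B; have W5 : 5 <= W by rewrite /W; lra.
have [g1 g2] := hol _ (kernel_hardy p1 c0).
have hpsi : holomorphic_RHP (fun z => kernel p c (G2 z) - kernel p c (G1 z)).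
  by move=> z z0; apply: derivableB; [exact: g2|exact: g1].
have := @line_integral_segment_le R p p1 _ N (N * m) (N * (m + 1))
  (r `^ (- p^-1) * W ^- 4) _ hpsi N0 _ _ (hL _ N N0 (kernel_hardy p1 c0) (kernel_le1 p1 c0)).
have W40 : 0 <= W ^- 4 by rewrite invr_ge0 exprn_ge0 //; lra.
rewrite powR_kernel_const // => main.
apply: le_trans (main _ _ _).
- have -> : N * (m + 1) - N * m = N by ring.
  rewrite le_eqVlt; apply/orP; left; apply/eqP; rewrite /r -/W.
  by field; rewrite !gt_eqF.
- by rewrite ler_pM2l //; lra.
- by rewrite mulr_ge0 ?powR_ge0.
move=> y /andP[y1 y2]; pose t := y / N.
have t1 : m <= t by rewrite ler_pdivlMr // mulrC.
have t2 : t <= m + 1 by rewrite ler_pdivrMr // mulrC.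
have yE : y = N * t by rewrite /t mulrC divfK // gt_eqF.
set z : C := N +i* y; have z0 : RHP z by [].
have t0 : 0 < t by lra.
have bt : `|(b - 1) * t| <= 1 + `|b - 1|.
  rewrite normrM (gtr0_norm t0).
  apply: le_trans (_ : `|b - 1| * (m + 1) <= _); first by rewrite ler_wpM2l.
  by rewrite mulrDr mulr1 bm.
have bt1 : 1 <= `|(b - 1) * t|.
  rewrite normrM (gtr0_norm t0).
  by rewrite -[leLHS]bm ler_wpM2l.
have cz : cmod z <= (m + 2) * N.
  apply: le_trans (cmod_le_ReIm _) _; rewrite /= yE normrM (gtr0_norm N0) (gtr0_norm t0).
  have : N * t <= N * (m + 1) by rewrite ler_wpM2l // ltW.
  lra.
have Nz : N <= cmod z := Re_cmod z.
have cz' : cmod z <= (m + 2) * complex.Re z by [].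
have e1 : eps * cmod z <= r / 4.
  apply: le_trans (_ : eps * ((m + 2) * N) <= _); first by rewrite ler_wpM2l // ltW.
  by rewrite le_eqVlt; apply/orP; left; apply/eqP; rewrite /eps /r; field; rewrite gt_eqF.
have {}a1 := le_trans (a1 z z0 cz' ltac:(rewrite /N in Nz; lra)) e1.
have {}a2 := le_trans (a2 z z0 cz' ltac:(rewrite /N in Nz; lra)) e1.
rewrite s1 in a1; rewrite s2 in a2.
set A1 := G1 z + c; set A2 := G2 z + c.
set E1 := G1 z - s%:C * z in a1; set E2 := G2 z - (s * b)%:C * z in a2.
have r1 : 0 < complex.Re (G1 z) := h1.2 z z0.
have r2 : 0 < complex.Re (G2 z) := h2.2 z z0.
pose V1 : C := (2 * r) +i* (r * (t - m)).
pose V2 : C := (r * (b + 1)) +i* (r * ((b - 1) * t + (t - m))).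
have E1V : A1 = E1 + V1.
  apply: ReIm_inj; rewrite /A1 /E1 ?ReD ?ImD ?ReN ?ImN ?ReM ?ImM /= yE /r; ring.
have E2V : A2 = E2 + V2.
  apply: ReIm_inj; rewrite /A2 /E2 ?ReD ?ImD ?ReN ?ImN ?ReM ?ImM /= yE /r; ring.
have tm : `|t - m| <= 1.
  by clear -t1 t2; rewrite ler_norml; apply/andP; split; lra.
have nb : `|b - 1| <= b + 1.
  by clear -b0; rewrite ler_norml; apply/andP; split; lra.
have v1 : cmod A1 <= r * W.
  rewrite E1V; apply: le_trans (cmodD _ _) _.
  have : cmod V1 <= 2 * r + r * 1.
    have r20 : 0 <= 2 * r by lra.
    apply: le_trans (cmod_le_ReIm _) _; rewrite /= (ger0_norm r20).
    by rewrite normrM (gtr0_norm r0) lerD2l ler_wpM2l // ltW.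
  have : r * 5 <= r * W by rewrite ler_wpM2l // ltW.
  lra.
have v2 : cmod A2 <= r * W.
  rewrite E2V; apply: le_trans (cmodD _ _) _.
  have : cmod V2 <= r * (b + 1) + r * (3 + b).
    apply: le_trans (cmod_le_ReIm _) _; rewrite /= (normrM r) (normrM r).
    rewrite (gtr0_norm r0) (ger0_norm (x := b + 1)); last lra.
    rewrite lerD2l ler_wpM2l ?(ltW r0) //.
    apply: le_trans (ler_normD _ _) _; lra.
  have : r * (5 + 2 * b) <= r * W by rewrite ler_wpM2l ?(ltW r0) // /W; lra.
  lra.
have dA : r / 2 <= cmod (A1 - A2).
  have -> : A1 - A2 = (E1 - E2) + (V1 - V2) by rewrite E1V E2V; ring.
  have h3 : r <= cmod (V1 - V2).
    apply: le_trans (norm_Im_cmod _); rewrite ImB /=.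
    have -> : r * (t - m) - r * ((b - 1) * t + (t - m)) = - (r * ((b - 1) * t)) by ring.
    rewrite normrN normrM gtr0_norm // -[leLHS]mulr1 ler_wpM2l // ltW //.
  have := cmodD (E1 - E2 + (V1 - V2)) (- (E1 - E2)).
  rewrite addrAC subrr add0r cmodN.
  have := cmodD E1 (- E2); rewrite cmodN; lra.
have sA : 2 * r <= cmod (A1 + A2).
  apply: le_trans (Re_cmod _); rewrite /A1 /A2 !ReD /=; lra.
have p1' : 0 < cmod A1.
  by apply: lt_le_trans (Re_cmod _); rewrite /A1 ReD addr_gt0.
have p2' : 0 < cmod A2.
  by apply: lt_le_trans (Re_cmod _); rewrite /A2 ReD addr_gt0.
have n1 : A1 != 0 by apply: contraTneq p1' => ->; rewrite cmod0 ltxx.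
have n2 : A2 != 0 by apply: contraTneq p2' => ->; rewrite cmod0 ltxx.
rewrite -/z /kernel -/A1 -/A2 (_ : complex.Re c = r) //.
set lam : R := r ^+ 2 * _.
have -> : lam%:C / A2 ^+ 2 - lam%:C / A1 ^+ 2 =
    lam%:C * ((A1 - A2) * (A1 + A2)) / (A1 * A1 * (A2 * A2)).
  by field; rewrite n1 n2.
have l0 : 0 <= lam by rewrite mulr_ge0 ?sqr_ge0 ?powR_ge0.
rewrite !cmodM cmodV !cmodM cmod_real ger0_norm //.
have den0 : 0 < cmod A1 * cmod A1 * (cmod A2 * cmod A2) by rewrite !mulr_gt0.
rewrite ler_pdivlMr //.
have den : cmod A1 * cmod A1 * (cmod A2 * cmod A2) <= r ^+ 4 * W ^+ 4.
  have -> : r ^+ 4 * W ^+ 4 = (r * W) * (r * W) * ((r * W) * (r * W)) by ring.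
  by rewrite !ler_pM ?mulr_ge0 ?cmod_ge0.
have num : r / 2 * (2 * r) <= cmod (A1 - A2) * cmod (A1 + A2).
  by rewrite ler_pM ?divr_ge0 ?mulr_ge0 // ltW.
apply: (@le_trans _ _ (r `^ (- p^-1) * W ^- 4 * (r ^+ 4 * W ^+ 4))).
  by rewrite ler_wpM2l // mulr_ge0 ?powR_ge0.
apply: (@le_trans _ _ (lam * (r / 2 * (2 * r)))); last by rewrite ler_wpM2l.
have W0 : W != 0 by rewrite gt_eqF //; lra.
rewrite le_eqVlt; apply/orP; left; apply/eqP; rewrite /lam; field.
by [].
Qed.

Variable F : R -> C -> C.
Hypothesis hF : holomorphic_semigroup F.
Hypothesis hT : forall t, 0 <= t -> bounded_linear p (composition_semigroup F t).

Let hFt : forall t, 0 <= t -> holomorphic_self_map (F t).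
Proof. by have [] := hF. Qed.

Lemma semigroup_slope_gt0 t : 0 <= t -> 0 < slope (F t).
Proof. by move=> t0; apply: (bounded_slope_gt0 p1); [exact: hFt|exact: hT]. Qed.

Lemma semigroup_slopeD t s : 0 <= t -> 0 <= s ->
  slope (F (t + s)) = slope (F t) * slope (F s).
Proof.
move=> t0 s0; have [_ hFD _] := hF; apply: slope_comp.
- exact: hFt.
- exact: hFt.
- by apply: hFt; rewrite addr_ge0.
- exact: hFD.
- exact: semigroup_slope_gt0.
- exact: semigroup_slope_gt0.
Qed.

Lemma semigroup_slopeM n t : 0 <= t -> slope (F (t *+ n.+1)) = slope (F t) ^+ n.+1.
Proof.
move=> t0; elim: n => [|n ih]; first by rewrite mulr1n expr1.
by rewrite mulrS semigroup_slopeD ?mulrn_wge0 // ih -exprS.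
Qed.

(** The slopes of [F (t / n)] stay bounded and differ from [1] if that of [F t]
    does. Then [F 1] and [F (1 + t / n)] have a fixed gap as composition operators,
    against the Lipschitz estimate at time [1]. *)
Theorem semigroup_slope_eq1 t : 0 < t ->
  analytically_extendable p (composition_semigroup F) -> slope (F t) = 1.
Proof.
move=> t0 [th1 [th2 [th10 th20 [S hS]]]].
have [K [d [K0 d0 hK]]] := analytic_lipschitz p1 th10 th20 hT hS.
apply/eqP/negPn/negP => st1.
pose s := slope (F 1); have s0 : 0 < s by exact: semigroup_slope_gt0.
pose B := Num.max 1 (slope (F t)).
have B1 : 1 <= B by rewrite le_max lexx.
pose kap := s^-1 * ((5 + 2 * B) ^- 4) `^ p.
have kap0 : 0 < kap.
  by rewrite mulr_gt0 ?invr_gt0 // powR_gt0 // invr_gt0 exprn_gt0 //; lra.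
pose e := Num.min (Num.min 1 d) (kap / (K + 1)).
have e0 : 0 < e by rewrite !lt_min ltr01 d0 divr_gt0 // ltr_wpDl.
pose n := Num.truncn (t / e).
have hn : t / e < n.+1%:R by exact: truncnS_gt.
pose h := t / n.+1%:R.
have h0 : 0 < h by rewrite divr_gt0.
have he : h < e by rewrite ltr_pdivrMr // mulrC -ltr_pdivrMr.
move: he; rewrite !lt_min => /andP[/andP[h1 hd] hk].
have th : t = h *+ n.+1 by rewrite -mulr_natr divfK.
have sth : slope (F t) = slope (F h) ^+ n.+1.
  by rewrite th semigroup_slopeM ?(ltW h0).
pose b := slope (F h); have b0 : 0 < b by apply: semigroup_slope_gt0; exact: ltW.
have b1 : b != 1 by apply: contra st1 => /eqP; rewrite sth -/b => ->; rewrite expr1n.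
have bB : b <= B.
  have [bl|bg] := leP b 1; first exact: le_trans B1.
  rewrite le_max; apply/orP; right; rewrite sth -/b -[leLHS]expr1 ler_eXn2l //.
have : kap <= h `^ p * K.
  apply: (@slope_gap (F 1) (F (1 + h)) s b B) => //.
  - exact: hFt.
  - by apply: hFt; rewrite addr_ge0 // ltW.
  - by rewrite semigroup_slopeD // ltW.
  - move=> phi hphi.
    have [H1 _ _] := hT (t := 1) ler01.
    have [H2 _ _] := hT (t := 1 + h) ltac:(by rewrite addr_ge0 // ltW).
    by split; [have [] := H1 _ hphi|have [] := H2 _ hphi].
  - by move=> phi x x0 hphi nphi; apply: hK => //; rewrite h0.
have : h `^ p <= h by apply: ge1r_powR; [rewrite h0 ltW|exact: ltW].
move: hk; rewrite ltr_pdivlMr ?ltr_wpDl // mulrDr mulr1 => hk hp hkap.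
have hf : kap <= h * K by rewrite (le_trans hkap) // ler_wpM2r.
by have := lt_le_trans hk hf; rewrite gtrDl ltNge (ltW h0).
Qed.

End AngularDerivativeOne.

(** * One-sided limits and completeness of the complex numbers *)

Section RightLimits.
Variable R : realType.
Local Notation C := R[i].

Lemma near0r (P : R -> Prop) :
  (\forall t \near 0^'+, P t) <-> exists2 d : R, 0 < d & forall t, 0 < t < d -> P t.
Proof.
split.
- move=> /nbhs_ballP[d /= d0 hd]; exists d => // t /andP[t0 td].
  by apply: hd => //; rewrite /ball /= sub0r normrN gtr0_norm.
- move=> [d d0 hd]; near=> t; apply: hd; apply/andP; split; near: t.
    exact: nbhs_right_gt.
  exact: nbhs_right_lt.
Unshelve. all: by end_near. Qed.

Lemma cvg_ReIm (T : Type) (G : set_system T) (FG : Filter G) (g : T -> C) (l : C) :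
  g @ G --> l -> complex.Re (g x) @[x --> G] --> complex.Re l /\
                 complex.Im (g x) @[x --> G] --> complex.Im l.
Proof.
move=> /cvg_cmod h; split; apply/cvgrPdist_lt => e e0; apply: filterS (h e e0) => x.
  by rewrite -ReB cmodB; exact: le_lt_trans (norm_Re_cmod _).
by rewrite -ImB cmodB; exact: le_lt_trans (norm_Im_cmod _).
Qed.

Lemma complex_cauchy_cvg (T : Type) (G : set_system T) (FG : ProperFilter G)
    (g : T -> C) :
  (forall e : R, 0 < e -> exists l, \forall x \near G, cmod (g x - l) < e) ->
  exists l : C, g @ G --> l.
Proof.
move=> h.
have cR : cvg (complex.Re (g x) @[x --> G]).
  apply/cauchy_cvgP/cauchy_exP => e /= e0; have [l hl] := h e e0.
  exists (complex.Re l); apply: filterS hl => x.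
  by rewrite /ball /= -ReB cmodB; exact: le_lt_trans (norm_Re_cmod _).
have cI : cvg (complex.Im (g x) @[x --> G]).
  apply/cauchy_cvgP/cauchy_exP => e /= e0; have [l hl] := h e e0.
  exists (complex.Im l); apply: filterS hl => x.
  by rewrite /ball /= -ImB cmodB; exact: le_lt_trans (norm_Im_cmod _).
exists (lim (complex.Re (g x) @[x --> G]) +i* lim (complex.Im (g x) @[x --> G])).
apply/cvg_cmod => e e0; have e20 : 0 < e / 2 by rewrite divr_gt0.
move/cvgrPdist_lt: cR => /(_ _ e20) hR.
move/cvgrPdist_lt: cI => /(_ _ e20) hI.
near=> x; rewrite cmodB; apply: le_lt_trans (cmod_le_ReIm _) _.
rewrite ReB ImB /=.
have : `|lim (complex.Re (g x) @[x --> G]) - complex.Re (g x)| < e / 2 by near: x.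
have : `|lim (complex.Im (g x) @[x --> G]) - complex.Im (g x)| < e / 2 by near: x.
lra.
Unshelve. all: by end_near. Qed.

End RightLimits.

(** * Escape of the orbits to infinity *)

Section ParabolicSemigroup.
Variable R : realType.
Local Notation C := R[i].
Variable F : R -> C -> C.
Hypothesis hF : holomorphic_semigroup F.
Hypothesis slope1 : forall t, 0 < t -> slope (F t) = 1.
Implicit Types (z w : C) (t s : R).

Definition displacement t z := F t z - z.
Local Notation U := displacement.

Lemma semigroup_self t : 0 <= t -> holomorphic_self_map (F t).
Proof. by have [h _ _] := hF; exact: h. Qed.

Lemma semigroup_RHP t z : 0 <= t -> RHP z -> RHP (F t z).
Proof. by move=> t0; exact: (semigroup_self t0).2. Qed.

Lemma semigroupD t s z : 0 <= t -> 0 <= s -> RHP z -> F t (F s z) = F (t + s) z.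
Proof. by have [_ h _] := hF => t0 s0; exact: h. Qed.

Lemma displacement_cvg0 z e : RHP z -> 0 < e -> exists2 d : R, 0 < d &
  forall t, 0 < t < d -> cmod (U t z) < e.
Proof.
by move=> z0 e0; have [_ _ h] := hF; apply/near0r; move/cvg_cmod: (h z z0); exact.
Qed.

Lemma semigroup0 z : RHP z -> F 0 z = z.
Proof.
move=> z0; apply/eqP; rewrite -subr_eq0; apply/eqP/cmod_eq0/eqP.
rewrite eq_le cmod_ge0 andbT; apply/ler_addgt0Pr => e e0; rewrite add0r.
have e20 : 0 < e / 2 by rewrite divr_gt0.
have z1 : RHP (F 0 z) by exact: semigroup_RHP.
have [d1 d10 h1] := displacement_cvg0 z0 e20.
have [d2 d20 h2] := displacement_cvg0 z1 e20.
pose t := Num.min d1 d2 / 2.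
have m0 : 0 < Num.min d1 d2 by rewrite lt_min d10.
have t0 : 0 < t by rewrite divr_gt0.
have tm : t < Num.min d1 d2 by rewrite /t; lra.
move: tm; rewrite lt_min => /andP[t1 t2].
have := h1 t ltac:(by rewrite t0); have := h2 t ltac:(by rewrite t0).
rewrite /U semigroupD ?(ltW t0) // addr0 => k1 k2.
have -> : F 0 z - z = (F t z - z) - (F t z - F 0 z) by ring.
apply: le_trans (cmodD _ _) _; rewrite cmodN; lra.
Qed.

Lemma displacementD t s z : 0 <= t -> 0 <= s -> RHP z ->
  U (t + s) z = U s z + U t (F s z).
Proof. by move=> t0 s0 z0; rewrite /U -semigroupD //; ring. Qed.

Lemma displacement0 z : RHP z -> U 0 z = 0.
Proof. by move=> z0; rewrite /U semigroup0 // subrr. Qed.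

(** As the slope is [1], [F t] moves every point to the right, so that the
    displacement has nonnegative real part. *)
Lemma displacement_pick t : 0 <= t -> pick (U t).
Proof.
move=> t0; apply: schwarz_pick.
  move=> z z0; apply: derivableB; first exact: (semigroup_self t0).1.
  exact: derivable_id.
move=> z z0; have [tp|tn] := ltP 0 t; last first.
  by rewrite (_ : t = 0) ?displacement0 //; apply/eqP; rewrite eq_le tn t0.
have := slope_le (semigroup_self t0) z0; rewrite slope1 // mul1r.
by rewrite /U ReB subr_ge0.
Qed.

Lemma Re_semigroup_ge t z : 0 <= t -> RHP z -> complex.Re z <= complex.Re (F t z).
Proof.
by move=> t0 z0; have := (displacement_pick t0).1 z z0; rewrite ReB subr_ge0.
Qed.

Lemma Re_semigroup_homo t s z : 0 <= t -> t <= s -> RHP z ->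
  complex.Re (F t z) <= complex.Re (F s z).
Proof.
move=> t0 ts z0; rewrite -(subrK t s) -semigroupD ?subr_ge0 //.
by apply: Re_semigroup_ge; [rewrite subr_ge0|exact: semigroup_RHP].
Qed.

Section BoundedOrbit.
Variables (z0 : C) (A : R).
Hypothesis z0p : RHP z0.
Hypothesis bounded_orbit : forall T : R, exists2 t, T < t & cmod (F t z0) < A.

(** [Re F t z0] increases to a finite limit, so [Re U s] is arbitrarily small
    at points of the orbit that stay in a fixed bounded region away from the
    boundary; Harnack's inequality carries this back to [z0]. *)
Lemma bounded_orbit_Re_displacement s : 0 <= s -> complex.Re (U s z0) = 0.
Proof.
move=> s0; have x0 : 0 < complex.Re z0 := z0p.
pose x := complex.Re z0.
have [pU hU] := displacement_pick s0.
apply/eqP; rewrite eq_le pU // andbT leNgt; apply/negP.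
set al := complex.Re (U s z0) => al0.
pose D := cmod z0 + `|A|; have D0 : 0 <= D by rewrite addr_ge0 ?cmod_ge0.
have D21 : 0 < D ^+ 2 + 1 by rewrite ltr_wpDl ?sqr_ge0.
(* With [Re (U s w) <= eta] the Schwarz-Pick inequality between [z0] and [w]
   fails. *)
pose eta := Num.min (al / 2) (al * x ^+ 2 / (8 * (D ^+ 2 + 1))).
have eta0 : 0 < eta.
  by rewrite lt_min !divr_gt0 ?mulr_gt0 ?exprn_gt0.
have eta1 : eta <= al / 2 by rewrite ge_min lexx.
have eta2 : eta * (8 * (D ^+ 2 + 1)) <= al * x ^+ 2.
  by rewrite -ler_pdivlMr ?mulr_gt0 // ge_min lexx orbT.
pose E := [set complex.Re (F t z0) | t in [set t | 0 <= t]].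
have hE : has_sup E.
  split; first by exists (complex.Re (F 0 z0)), 0 => //=.
  exists A => _ [t t0 <-]; have [t' tt' h] := bounded_orbit t.
  apply: le_trans (Re_semigroup_homo t0 (ltW tt') z0p) _.
  by apply: le_trans (Re_cmod _) _; exact: ltW.
have [_ [t1 t10 <-] ht1] := sup_adherent eta0 hE.
have [t tt1 tA] := bounded_orbit t1.
have t0 : 0 <= t by rewrite (le_trans t10) // ltW.
pose w := F t z0; have wp : RHP w by exact: semigroup_RHP.
have be : complex.Re (U s w) <= eta.
  have h1 : complex.Re (F (s + t) z0) <= sup E.
    by apply: (ub_le_sup hE.2); exists (s + t) => //=; rewrite addr_ge0.
  have h2 := Re_semigroup_homo t10 (ltW tt1) z0p.
  rewrite /U ReB /w semigroupD //; lra.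
have xw : x <= complex.Re w by exact: Re_semigroup_ge.
have := hU z0 w z0p wp; have := pU w wp; rewrite -/al.
set be' := complex.Re (U s w) in be *; move=> be0 h.
have d1 : (al - be') ^+ 2 <= cmod (U s z0 - U s w) ^+ 2.
  rewrite sqr_cmod ReB -/al -/be' lerDl; exact: sqr_ge0.
have d2 : cmod (z0 - w) ^+ 2 <= D ^+ 2.
  rewrite ler_sqr ?nnegrE ?cmod_ge0 //; apply: le_trans (cmodD _ _) _.
  by rewrite cmodN /D lerD2l; apply: le_trans (ltW tA) _; exact: ler_norm.
have d3 : (al / 2) ^+ 2 <= (al - be') ^+ 2 by rewrite ler_sqr ?nnegrE; lra.
have xx : x * x <= x * complex.Re w by rewrite ler_wpM2l // ltW.
have k1 : (al / 2) ^+ 2 * (x * x) <= al * be' * D ^+ 2.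
  apply: le_trans (_ : cmod (U s z0 - U s w) ^+ 2 * (x * complex.Re w) <= _).
    apply: ler_pM => //; rewrite ?sqr_ge0 ?mulr_ge0 ?(ltW x0) //.
    exact: le_trans d3 d1.
  by apply: le_trans h _; rewrite ler_wpM2l // mulr_ge0 // ltW.
have k2 : al * be' * D ^+ 2 <= al * eta * (D ^+ 2 + 1).
  apply: ler_pM; rewrite ?mulr_ge0 ?sqr_ge0 ?(ltW al0) //; last by rewrite lerDl.
  by rewrite ler_wpM2l // ltW.
have k3 : al * (eta * (8 * (D ^+ 2 + 1))) <= al * (al * x ^+ 2).
  by rewrite ler_wpM2l // ltW.
have k4 : 0 < al * (al * x ^+ 2) by rewrite !mulr_gt0 // exprn_gt0.
have e1 : (al / 2) ^+ 2 * (x * x) = al * (al * x ^+ 2) / 4 by field.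
have e2 : al * (eta * (8 * (D ^+ 2 + 1))) = 8 * (al * eta * (D ^+ 2 + 1)) by ring.
lra.
Qed.

Lemma bounded_orbit_translation s z : 0 <= s -> RHP z -> U s z = U s z0.
Proof.
move=> s0 zp; apply: (pick_rigid (displacement_pick s0)) => //.
exact: bounded_orbit_Re_displacement.
Qed.

(** The [F t] are now translations, with displacement additive in [t] and bounded
    for small [t]; writing [t = n * t1 + r] shows that the orbit is unbounded as
    soon as [F t1] moves a point. *)
Lemma bounded_orbit_trivial : ~ nontrivial_semigroup F.
Proof.
move=> [t1 [z [t10 zp Fz]]].
have add t s : 0 <= t -> 0 <= s -> U (t + s) z0 = U s z0 + U t z0.
  move=> t0 s0; rewrite displacementD // bounded_orbit_translation //.
  exact: semigroup_RHP.
have muln n t : 0 <= t -> U (t *+ n) z0 = U t z0 *+ n.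
  move=> t0; elim: n => [|n ih]; first by rewrite !mulr0n displacement0.
  by rewrite mulrS add ?mulrn_wge0 // ih mulrSr.
have U1 : U t1 z0 != 0.
  rewrite -(bounded_orbit_translation t10 zp) /U subr_eq0; exact/eqP.
have t1p : 0 < t1.
  rewrite lt_neqAle t10 andbT; apply: contraNneq U1 => <-.
  by rewrite displacement0.
pose e := cmod (U t1 z0); have e0 : 0 < e by exact: cmod_gt0.
have [d d0 hd] := displacement_cvg0 z0p ltr01.
pose N := (Num.truncn (t1 / d)).+1.
have hN : t1 / d < N%:R by exact: truncnS_gt.
have N0 : 0 < N%:R :> R by rewrite ltr0n.
have small r : 0 <= r < t1 -> cmod (U r z0) <= N%:R.
  move=> /andP[r0 rt].
  have -> : r = (r / N%:R) *+ N by rewrite -mulr_natr divfK // gt_eqF.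
  rewrite muln ?divr_ge0 // cmodMn -[leRHS]mul1r ler_wpM2r //.
  move: r0; rewrite le_eqVlt => /predU1P[<-|r0].
    by rewrite mul0r displacement0 // cmod0.
  apply/ltW/hd; rewrite divr_gt0 //= ltr_pdivrMr // mulrC -ltr_pdivrMr //.
  apply: lt_trans hN; by rewrite ltr_pM2r ?invr_gt0.
pose Q := (`|A| + cmod z0 + N%:R) / e + 1.
have Q0 : 0 <= Q by rewrite addr_ge0 // divr_ge0 ?addr_ge0 ?cmod_ge0 // ltW.
have [t tT tA] := bounded_orbit (Q * t1).
have t0 : 0 < t by apply: le_lt_trans tT; rewrite mulr_ge0.
pose n := Num.truncn (t / t1).
have /andP[n1 n2] := truncn_itv (divr_ge0 (ltW t0) t10).
rewrite -/n in n1 n2.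
have n1' : t1 *+ n <= t by rewrite -mulr_natr mulrC -ler_pdivlMr.
have n2' : t < t1 *+ n + t1.
  by rewrite -mulrSr -mulr_natr mulrC -ltr_pdivrMr.
have hr : cmod (U (t - t1 *+ n) z0) <= N%:R.
  by apply: small; rewrite subr_ge0 n1' ltrBlDl.
have Qn : Q < n%:R + 1.
  have : Q < t / t1 by rewrite ltr_pdivlMr.
  by move=> h; apply: lt_trans h _; rewrite natr1.
have Ut : U t z0 = U t1 z0 *+ n + U (t - t1 *+ n) z0.
  by rewrite -muln // -add ?subr_ge0 ?mulrn_wge0 // subrK.
have : e * n%:R <= cmod (F t z0) + cmod z0 + N%:R.
  have -> : e * n%:R = cmod (U t1 z0 *+ n) by rewrite cmodMn.
  have -> : U t1 z0 *+ n = F t z0 - z0 - U (t - t1 *+ n) z0.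
    by rewrite -[F t z0 - z0]/(U t z0) Ut addrK.
  apply: le_trans (cmodD _ _) _; rewrite cmodN lerD //.
  by apply: le_trans (cmodD _ _) _; rewrite cmodN.
have : (`|A| + cmod z0 + N%:R) < e * n%:R.
  by rewrite mulrC -ltr_pdivrMr //; move: Qn; rewrite /Q; lra.
have := ler_norm A; lra.
Qed.

End BoundedOrbit.

Theorem semigroup_escapes : nontrivial_semigroup F -> Denjoy_Wolff_at_infinity F.
Proof.
move=> hnt z zp; apply/cvgryPge => A; apply: contrapT => hA.
apply: (@bounded_orbit_trivial z A zp _ hnt) => T.
apply: contrapT => hT; apply: hA; exists T; split; first exact: num_real.
move=> t Tt /=; rewrite leNgt; apply/negP => tA; apply: hT.
by exists t.
Qed.

End ParabolicSemigroup.

(** * The generator *)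

Section Generator.
Variable R : realType.
Local Notation C := R[i].
Variable F : R -> C -> C.
Hypothesis hF : holomorphic_semigroup F.
Hypothesis slope1 : forall t, 0 < t -> slope (F t) = 1.
Implicit Types (z w : C) (t s : R).
Local Notation U := (displacement F).

(** Along a short piece of orbit the displacement is constant up to a small
    relative error, by Harnack's inequality. *)
Lemma displacement_orbit z e : RHP z -> 0 < e <= 1 -> exists2 tau : R, 0 < tau &
  forall t v, 0 <= t < tau -> 0 <= v ->
    cmod (U v (F t z) - U v z) <= e * cmod (U v z).
Proof.
move=> z0 /andP[e0 e1]; have x0 : 0 < complex.Re z := z0.
have d0 : 0 < e / 2 * complex.Re z by rewrite mulr_gt0 // divr_gt0.
have [tau tau0 htau] := displacement_cvg0 hF z0 d0.
exists tau => // t v /andP[t0 tt] v0.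
have -> : e = 2 * (e / 2) by field.
apply: (pick_harnack (displacement_pick hF slope1 v0)) => //.
- exact: semigroup_RHP.
- by apply/andP; split; lra.
have ut : cmod (F t z - z) <= e / 2 * complex.Re z.
  move: t0; rewrite le_eqVlt => /predU1P[<-|t0].
    by rewrite semigroup0 // subrr cmod0 ltW.
  by apply/ltW/htau; rewrite t0.
apply: (@le_trans _ _ ((e / 2 * complex.Re z) ^+ 2)).
  by rewrite ler_sqr ?nnegrE ?cmod_ge0 // ltW.
rewrite exprMn ler_wpM2l ?sqr_ge0 // expr2 ler_wpM2r ?(ltW x0) //.
exact: Re_semigroup_ge.
Qed.

Lemma displacement_muln z e tau s n : RHP z ->
  (forall t v, 0 <= t < tau -> 0 <= v ->
    cmod (U v (F t z) - U v z) <= e * cmod (U v z)) ->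
  0 <= s -> s *+ n < tau ->
  cmod (U (s *+ n) z - U s z *+ n) <= e * cmod (U s z) *+ n.
Proof.
move=> z0 htau s0; elim: n => [|n ih] hn.
  by rewrite !mulr0n displacement0 // subrr cmod0.
have hn' : s *+ n < tau by apply: le_lt_trans hn; rewrite mulrS lerDr.
rewrite !mulrS displacementD ?mulrn_wge0 //.
have -> : U (s *+ n) z + U s (F (s *+ n) z) - (U s z + U s z *+ n) =
   (U s (F (s *+ n) z) - U s z) + (U (s *+ n) z - U s z *+ n) by ring.
apply: le_trans (cmodD _ _) _; apply: lerD; last exact: ih.
by apply: htau => //; rewrite mulrn_wge0.
Qed.

(** Euclidean division of the time [t] by the step [s]: the displacement of [t] is
    [n] times that of [s], up to a relative error and a remainder. *)
Lemma displacement_compare z e tau t s : RHP z -> 0 <= e <= 1 ->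
  (forall t v, 0 <= t < tau -> 0 <= v ->
    cmod (U v (F t z) - U v z) <= e * cmod (U v z)) ->
  0 < s -> 0 <= t < tau -> exists n r,
  [/\ 0 <= r < s, t = s *+ n + r &
    cmod (U t z - U s z *+ n) <= e * cmod (U s z) *+ n + 2 * cmod (U r z)].
Proof.
move=> z0 /andP[e0 e1] htau s0 /andP[t0 tt]; pose n := Num.truncn (t / s).
have /andP[n1 n2] := truncn_itv (divr_ge0 t0 (ltW s0)); rewrite -/n in n1 n2.
have n1' : s *+ n <= t by rewrite -mulr_natr mulrC -ler_pdivlMr.
have n2' : t < s *+ n + s by rewrite -mulrSr -mulr_natr mulrC -ltr_pdivrMr.
exists n, (t - s *+ n); split.
- by rewrite subr_ge0 n1' ltrBlDl.
- by rewrite addrC subrK.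
set r := t - _; have r0 : 0 <= r by rewrite subr_ge0.
have sn0 : 0 <= s *+ n by rewrite mulrn_wge0 // ltW.
have snt : s *+ n < tau by exact: le_lt_trans tt.
have tE : t = r + s *+ n by rewrite subrK.
rewrite tE displacementD //.
have -> : U (s *+ n) z + U r (F (s *+ n) z) - U s z *+ n =
   (U (s *+ n) z - U s z *+ n) + ((U r (F (s *+ n) z) - U r z) + U r z) by ring.
apply: le_trans (cmodD _ _) _; apply: lerD.
  exact: displacement_muln htau (ltW s0) snt.
apply: le_trans (cmodD _ _) _.
have : cmod (U r (F (s *+ n) z) - U r z) <= e * cmod (U r z).
  by apply: htau => //; rewrite sn0.
have : e * cmod (U r z) <= 1 * cmod (U r z) by rewrite ler_wpM2r ?cmod_ge0.
lra.
Qed.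

Lemma displacement_small z k : RHP z -> 0 < k -> exists2 d : R, 0 < d &
  forall t, 0 <= t < d -> cmod (U t z) <= k.
Proof.
move=> z0 k0; have [d d0 hd] := displacement_cvg0 hF z0 k0.
exists d => // t /andP[]; rewrite le_eqVlt => /predU1P[<- _|t0 td].
  by rewrite displacement0 // cmod0 ltW.
by apply/ltW/hd; rewrite t0.
Qed.

Lemma displacement_rate z : RHP z -> exists Q d : R, [/\ 0 <= Q, 0 < d &
  forall s, 0 < s < d -> cmod (U s z) <= Q * s].
Proof.
move=> z0; have [tau tau0 htau] := displacement_orbit z0 (e := 2^-1) ltac:(apply/andP; split; lra).
have [d d0 hd] := displacement_small z0 ltr01.
pose t := tau / 2; have t0 : 0 < t by rewrite divr_gt0.
pose Q := 4 * (cmod (U t z) + 2) / t.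
exists Q, (Num.min d (t / 2)); split.
- by rewrite divr_ge0 ?mulr_ge0 ?addr_ge0 ?cmod_ge0 // ltW.
- by rewrite lt_min d0 divr_gt0.
move=> s; rewrite lt_min => /and3P[s0 sd st].
have [n [r [/andP[r0 rs] tE h]]] := displacement_compare z0 (e := 2^-1)
  ltac:(apply/andP; split; lra) htau s0 (t := t) ltac:(rewrite (ltW t0) /t; lra).
have Ur : cmod (U r z) <= 1 by apply: hd; rewrite r0 (lt_trans rs).
have h1 : cmod (U s z) * n%:R <= cmod (U t z) + (2^-1 * cmod (U s z) * n%:R + 2).
  rewrite -cmodMn (_ : U s z *+ n = U t z - (U t z - U s z *+ n)); last by ring.
  apply: le_trans (cmodD _ _) _; rewrite cmodN lerD2l.
  apply: le_trans h _; rewrite mulr_natr lerD2l; lra.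
have {}h1 : cmod (U s z) * n%:R <= 2 * (cmod (U t z) + 2) by lra.
have tn : t / 2 <= s * n%:R by rewrite mulr_natr; lra.
have : cmod (U s z) * (t / 2) <= cmod (U s z) * (s * n%:R).
  by rewrite ler_wpM2l ?cmod_ge0.
have : s * (cmod (U s z) * n%:R) <= s * (2 * (cmod (U t z) + 2)).
  by rewrite ler_wpM2l // ltW.
move=> h2 h3; rewrite /Q [leRHS]mulrAC ler_pdivlMr //; lra.
Qed.

(** The difference quotients at [0] form a Cauchy family: by the preceding
    comparison, [U t / t] differs little from [U s / s] once [t] is small and
    [s] much smaller. *)
Theorem generator_exists : exists f, is_generator F f.
Proof.
suff h z : exists l : C, RHP z -> (F t z - z) / t%:C @[t --> 0^'+] --> l.
  by have [f hf] := choice h; exists f => z; exact: hf.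
have [z0|nz] := pselect (RHP z); last by exists 0.
suff [l hl] : exists l : C, (F t z - z) / t%:C @[t --> 0^'+] --> l by exists l.
apply: complex_cauchy_cvg => eta eta0.
have [Q [d1 [Q0 d10 hQ]]] := displacement_rate z0.
(* The relative error [e] of Harnack's comparison costs [e * Q <= eta / 4], and
   the remainders, bounded by [eta * t / 12] each, another [eta / 4]. *)
pose e := Num.min 1 (eta / (4 * (Q + 1))).
have e0 : 0 < e by rewrite lt_min ltr01 divr_gt0 // mulr_gt0 // ltr_wpDl.
have e1 : e <= 1 by rewrite ge_min lexx.
have eQ : e * Q <= eta / 4.
  have : e <= eta / (4 * (Q + 1)) by rewrite ge_min lexx orbT.
  rewrite ler_pdivlMr; last by rewrite mulr_gt0 // ltr_wpDl.
  have -> : e * (4 * (Q + 1)) = 4 * (e * Q) + 4 * e by ring.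
  by clear -e0; lra.
have [tau tau0 htau] := displacement_orbit z0 (e := e) ltac:(by rewrite e0).
pose t := tau / 2; have t0 : 0 < t by rewrite divr_gt0.
have k0 : 0 < eta * t / 12 by rewrite divr_gt0 // mulr_gt0.
have [d d0 hd] := displacement_small z0 k0.
exists (U t z / t%:C); apply/near0r; exists (Num.min d d1); first by rewrite lt_min d0.
move=> s; rewrite lt_min => /and3P[s0 sd sd1]; rewrite -/(U s z).
have [n [r [/andP[r0 rs] tE h]]] := displacement_compare z0 (e := e)
  ltac:(by rewrite e1 ltW) htau s0 (t := t) ltac:(rewrite (ltW t0) /t; lra).
have Ur : cmod (U r z) <= eta * t / 12 by apply: hd; rewrite r0 (lt_trans rs).
have Us : cmod (U s z) <= eta * t / 12 by apply: hd; rewrite (ltW s0).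
have {}hQ : cmod (U s z) <= Q * s by apply: hQ; rewrite s0.
have tn0 : t%:C != 0 :> C by apply/eqP => /complexI /eqP; rewrite gt_eqF.
have sn0 : s%:C != 0 :> C by apply/eqP => /complexI /eqP; rewrite gt_eqF.
have tC : t%:C = s%:C * n%:R + r%:C :> C.
  by rewrite tE rmorphD /= rmorphMn /= mulr_natr.
rewrite cmodB.
have -> : U t z / t%:C - U s z / s%:C =
    ((U t z - U s z *+ n) - (r / s)%:C * U s z) / t%:C.
  have -> : (r / s)%:C = (t%:C - s%:C * n%:R) / s%:C :> C.
    by rewrite tC [X in X - _]addrC addrK fmorph_div.
  rewrite -[U s z *+ n]mulr_natr.
  by field; rewrite tn0 sn0.
rewrite cmodM cmodV cmod_real gtr0_norm // ltr_pdivrMr //.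
apply: le_lt_trans (cmodD _ _) _; rewrite cmodN cmodM cmod_real.
have q1 : `|r / s| * cmod (U s z) <= 1 * (eta * t / 12).
  apply: ler_pM => //; first exact: cmod_ge0.
  by rewrite ger0_norm ?divr_ge0 ?(ltW s0) // ler_pdivrMr // mul1r ltW.
have q2 : e * cmod (U s z) *+ n <= eta / 4 * t.
  rewrite -mulr_natr; apply: le_trans (_ : e * (Q * s) * n%:R <= _).
    by rewrite ler_wpM2r // ler_wpM2l // ltW.
  have -> : e * (Q * s) * n%:R = e * Q * (s *+ n) by rewrite -[s *+ n]mulr_natr; ring.
  apply: ler_pM => //; first by rewrite mulr_ge0 // ltW.
    by rewrite mulrn_wge0 // ltW.
  by rewrite tE lerDl.
have q3 : 0 < eta * t by rewrite mulr_gt0.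
lra.
Qed.

Variable f : C -> C.
Hypothesis hf : is_generator F f.

Let quotient_ReIm t z : complex.Re ((F t z - z) / t%:C) = complex.Re (U t z) / t /\
  complex.Im ((F t z - z) / t%:C) = complex.Im (U t z) / t.
Proof. by rewrite -fmorphV /= ReM ImM /= !mulr0 subr0 add0r. Qed.

(** The inequality holds for [U t / t] and is closed under limits. *)
Lemma generator_pick : pick f.
Proof.
have cv z : RHP z -> complex.Re (U t z) / t @[t --> 0^'+] --> complex.Re (f z) /\
    complex.Im (U t z) / t @[t --> 0^'+] --> complex.Im (f z).
  move=> z0; have [h1 h2] := cvg_ReIm _ (hf z0).
  split; [move: h1|move: h2]; apply: cvg_trans; apply: near_eq_cvg;
    near=> t; by have [q1 q2] := quotient_ReIm t z; rewrite ?q1 ?q2.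
split.
  move=> z z0; have [h _] := cv z z0.
  apply: (@ler_cvg_to _ _ _ _ (fun=> 0) _ _ _ _ h); first exact: cvg_cst.
  apply/near0r; exists 1 => // t /andP[t0 _].
  by rewrite divr_ge0 ?(ltW t0) // (displacement_pick hF slope1 (ltW t0)).1.
move=> z w z0 w0; have [hz1 hz2] := cv z z0; have [hw1 hw2] := cv w w0.
rewrite [cmod (f z - f w) ^+ 2]sqr_cmod ReB ImB.
have L : ((complex.Re (U t z) / t - complex.Re (U t w) / t) ^+ 2 +
  (complex.Im (U t z) / t - complex.Im (U t w) / t) ^+ 2) *
  (complex.Re z * complex.Re w) @[t --> 0^'+] -->
  ((complex.Re (f z) - complex.Re (f w)) ^+ 2 +
   (complex.Im (f z) - complex.Im (f w)) ^+ 2) * (complex.Re z * complex.Re w).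
  apply: cvgM; last exact: cvg_cst.
  by apply: cvgD; apply: cvgM; apply: cvgB.
have Rr : (complex.Re (U t z) / t) * (complex.Re (U t w) / t) * cmod (z - w) ^+ 2
  @[t --> 0^'+] --> complex.Re (f z) * complex.Re (f w) * cmod (z - w) ^+ 2.
  by apply: cvgM; [apply: cvgM|exact: cvg_cst].
apply: (ler_cvg_to L Rr); apply/near0r; exists 1 => // t /andP[t0 _].
have := (displacement_pick hF slope1 (ltW t0)).2 z w z0 w0.
rewrite [cmod (U t z - U t w) ^+ 2]sqr_cmod ReB ImB => h.
have t2 : 0 < t^-1 ^+ 2 by rewrite exprn_gt0 // invr_gt0.
rewrite -(ler_pM2l t2) in h.
rewrite (_ : (_ + _) * _ = t^-1 ^+ 2 *
  (((complex.Re (U t z) - complex.Re (U t w)) ^+ 2 +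
    (complex.Im (U t z) - complex.Im (U t w)) ^+ 2) * (complex.Re z * complex.Re w)));
  last by ring.
apply: le_trans h _; rewrite le_eqVlt; apply/orP; left; apply/eqP; ring.
Unshelve. all: by end_near. Qed.

(** If [Re f] dominated a positive multiple of [Re z], integrating along orbits
    would give [F 1] an angular derivative larger than [1]. *)
Lemma generator_slope0 eps : 0 < eps ->
  exists2 z, RHP z & complex.Re (f z) <= eps * complex.Re z.
Proof.
move=> e0; apply: contrapT => hn.
have hgt z : RHP z -> eps * complex.Re z < complex.Re (f z).
  by move=> z0; rewrite ltNge; apply/negP => h; apply: hn; exists z.
have e20 : 0 < eps / 2 by rewrite divr_gt0.
suff h z : RHP z -> (1 + eps / 2) * complex.Re z <= complex.Re (F 1 z).
  have := slope_ge h; rewrite slope1 //; lra.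
move=> z0; pose x := complex.Re z; have x0 : 0 < x := z0.
(* Continuous induction on the times at which the orbit has gained enough. *)
pose S := [set t : R | 0 <= t <= 1 /\ (1 + eps / 2 * t) * x <= complex.Re (F t z)].
have S0 : S 0.
  by split; [rewrite lexx ler01 | rewrite mulr0 addr0 mul1r semigroup0].
have hS : has_sup S.
  by split; [exists 0 | exists 1 => t [/andP[]]].
pose T := sup S.
have T0 : 0 <= T by exact: (ub_le_sup hS.2).
have T1 : T <= 1 by apply: (ge_sup hS.1) => t [/andP[]].
have ex : 0 < eps / 2 * x by rewrite mulr_gt0.
have ST : S T.
  split; first by rewrite T0.
  apply/ler_addgt0Pr => k k0; have k1 : 0 < k / (eps / 2 * x) by rewrite divr_gt0.
  have [t [/andP[t0 t1] ht] hT] := sup_adherent k1 hS.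
  have tT : t <= T by apply: (ub_le_sup hS.2); split; rewrite ?t0.
  have h1 := Re_semigroup_homo hF slope1 t0 tT z0.
  have : (T - t) * (eps / 2 * x) <= k.
    by rewrite -ler_pdivlMr //; rewrite -/T in hT; lra.
  lra.
have [T1'|T1'] := ltP T 1; last first.
  have TE : T = 1 by apply/eqP; rewrite eq_le T1.
  by case: ST => _; rewrite TE mulr1.
exfalso; pose w := F T z; have wp : RHP w by exact: semigroup_RHP.
have xw : x <= complex.Re w by exact: Re_semigroup_ge.
have g1 : eps * x < complex.Re (f w).
  by apply: le_lt_trans (hgt w wp); rewrite ler_wpM2l // ltW.
have gap : 0 < complex.Re (f w) - eps / 2 * x by lra.
have /cvg_cmod/(_ _ gap)/near0r [d d0 hd] := hf wp.
pose h := Num.min d (1 - T) / 2.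
have m0 : 0 < Num.min d (1 - T) by rewrite lt_min d0 subr_gt0.
have h0 : 0 < h by rewrite divr_gt0.
have : h < Num.min d (1 - T) by rewrite /h; lra.
rewrite lt_min => /andP[hd1 h1].
have := hd h ltac:(by rewrite h0).
move=> /(le_lt_trans (norm_Re_cmod _)); rewrite ReB (quotient_ReIm h w).1.
rewrite ltr_norml => /andP[k1 _].
have k2 : eps / 2 * x < complex.Re (U h w) / h by lra.
rewrite ltr_pdivlMr // /U ReB /w semigroupD ?(ltW h0) // -/w in k2.
have : S (T + h).
  split; first by apply/andP; split; lra.
  case: ST => _ sT; rewrite [T + h]addrC; rewrite -/w in sT; lra.
move=> /(ub_le_sup hS.2); rewrite -/T; lra.
Qed.

Theorem generator_angular : angular_limit_at_infinity (fun z => f z / (z + 1)) 0.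
Proof.
move=> M eps e0; have e20 : 0 < eps / 2 by rewrite divr_gt0.
have [K _ hK] := pick_julia generator_pick generator_slope0 M e20.
exists K => z z0 zM zK; rewrite subr0 cmodM cmodV.
have zz : cmod z <= cmod (z + 1).
  rewrite -ler_sqr ?nnegrE ?cmod_ge0 // !sqr_cmod ReD ImD /= addr0 lerD2r.
  have x0 : 0 < complex.Re z := z0.
  rewrite ler_sqr ?nnegrE; lra.
have z1 : 0 < cmod (z + 1).
  apply: lt_le_trans zz; apply: lt_le_trans (Re_cmod _); exact: z0.
rewrite ltr_pdivrMr //; apply: le_lt_trans (hK z z0 zM zK) _.
apply: (@le_lt_trans _ _ (eps / 2 * cmod (z + 1))).
  by rewrite ler_wpM2l // ltW.
by rewrite ltr_pM2r //; lra.
Qed.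

End Generator.

Theorem corollary4p3 (R : realType) (p : R) (F : R -> R[i] -> R[i]) :
  1 < p ->
  holomorphic_semigroup F ->
  nontrivial_semigroup F ->
  C0_semigroup p (composition_semigroup F) ->
  analytically_extendable p (composition_semigroup F) ->
  parabolic_type F.
Proof.
move=> p1 hF hnt [hT _ _ _] hA.
have slope1 t : 0 < t -> slope (F t) = 1.
  by move=> t0; exact: (semigroup_slope_eq1 p1).
split; first exact: semigroup_escapes.
have [f hf] := generator_exists hF slope1.
by exists f; split; last exact: generator_angular hf.
Qed.
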